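(* Let $G,H$ be two graphs, with $H$ uniformly locally finite, and let $1 \in G$ be a basepoint. Then the wreath product $G \wr H = (G,1)\wr H$ coarsely embeds in a Hilbert space if and only if both $G$ and $H$ coarsely embed in Hilbert spaces.
   Context: Graphs are connected, identified with their vertex-sets, and viewed as metric spaces through the shortest-path metric. A graph is uniformly locally finite if there is a uniform upper bound on the degrees of its vertices. Wreath product of graphs: given graphs $G,H$ and a basepoint $1 \in G$, let $G^{(H)}$ denote the set of maps $\varphi : H \to G$ such that $\varphi(k)=1$ for all but finitely many $k \in H$. The wreath product $(G,1)\wr H$ is the graph whose vertices are the pairs $(\varphi,h)$ with $\varphi \in G^{(H)}$ and $h \in H$, and in which $(\varphi_1,h_1)$ and $(\varphi_2,h_2)$ are linked by an edge if either $\varphi_1=\varphi_2$ and $h_1,h_2$ are adjacent in $H$, or $h_1=h_2$ and $\varphi_1,\varphi_2$ differ only at $h_1=h_2$, with $\varphi_1(h_1),\varphi_2(h_1)$ adjacent in $G$. A map $f : R \to S$ between metric spaces is a coarse embedding if there exist non-decreasing functions $\rho_-,\rho_+ : [0,\infty) \to [0,\infty)$ with $\rho_-(t) \to \infty$ as $t \to \infty$ such that $\rho_-(d(a,b)) \leq d(f(a),f(b)) \leq \rho_+(d(a,b))$ for all $a,b \in R$. *)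

(* Defs.v *)
From HB Require Import structures.
From mathcomp Require Import all_boot all_order all_algebra sesquilinear.
From mathcomp Require Import all_classical all_reals all_analysis.

Set Implicit Arguments.
Unset Strict Implicit.
Unset Printing Implicit Defensive.

Import Order.TTheory GRing.Theory Num.Theory.
Import numFieldNormedType.Exports.

Local Open Scope classical_set_scope.
Local Open Scope ring_scope.

(* Simple graphs on an arbitrary, possibly infinite, vertex type. Any
   Prop-valued adjacency can be made boolean by classical reflection. *)
Record graph := Graph {
  vertex :> Type;
  adj : rel vertex;
  adj_sym : symmetric adj;
  adj_irr : irreflexive adj }.

Definition walk (G : graph) (x y : G) (n : nat) : Prop :=
  exists p : seq G, [/\ path (@adj G) x p, last x p = y & size p = n].

(* The empty graph is not connected. *)
Definition connected_graph (G : graph) : Prop :=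
  inhabited G /\ forall x y : G, exists n, walk x y n.

Definition uniformly_locally_finite (G : graph) : Prop :=
  exists d : nat, forall x : G, ([set y : G | adj x y] #<= `I_d)%card.

(* Shortest-path distance; the value 0%N is junk, used only when x and y lie in
   different components, hence never in a connected graph. *)
Definition gdist (G : graph) (x y : G) : nat :=
  if pselect (exists n, `[< walk x y n >]) is left ex then ex_minn ex else 0%N.

Definition lamp_config (G : graph) (o : G) (H : graph) : Type :=
  {phi : H -> G | finite_set [set k | phi k <> o]}.

Definition wreath_vertex (G : graph) (o : G) (H : graph) : Type :=
  (lamp_config o H * H)%type.

Definition wreath_edge (G : graph) (o : G) (H : graph)
    (u v : wreath_vertex o H) : Prop :=
  (u.1 = v.1 /\ adj u.2 v.2) \/
  [/\ u.2 = v.2,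
      forall k : H, k <> u.2 -> sval u.1 k = sval v.1 k
    & adj (sval u.1 u.2) (sval v.1 u.2)].

Definition wreath_adj (G : graph) (o : G) (H : graph) :
    rel (wreath_vertex o H) :=
  fun u v => `[< wreath_edge u v >].

Lemma wreath_edge_sym (G : graph) (o : G) (H : graph)
  (u v : wreath_vertex o H) : wreath_edge u v -> wreath_edge v u.
Proof.
move=> [[e a]|[e d a]]; first by left; rewrite adj_sym.
right; rewrite -e; split=> //; last by rewrite adj_sym.
by move=> k /d ->.
Qed.

Lemma wreath_adj_sym (G : graph) (o : G) (H : graph) :
  symmetric (@wreath_adj G o H).
Proof.
by move=> u v; apply/asboolP/asboolP; apply: wreath_edge_sym.
Qed.

Lemma wreath_adj_irr (G : graph) (o : G) (H : graph) :
  irreflexive (@wreath_adj G o H).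
Proof.
by move=> u; apply/asboolPn => -[[_]|[_ _]]; rewrite adj_irr.
Qed.

Definition wreath (G : graph) (o : G) (H : graph) : graph :=
  Graph (@wreath_adj_sym G o H) (@wreath_adj_irr G o H).

(* Real Hilbert spaces: complete normed spaces whose norm comes from an inner
   product. For theta := idfun, {dot V for theta} is the type of symmetric
   positive definite bilinear forms. *)
Record hilbertSpace (R : realType) := HilbertSpace {
  hilbert_sort :> completeNormedModType R;
  inner : {dot hilbert_sort for idfun};
  inner_norm : forall u : hilbert_sort, `|u| ^+ 2 = inner u u }.

(* rho restricts to a non-decreasing function [0, +oo[ -> [0, +oo[; its values
   at negative arguments are irrelevant. *)
Definition control_function (R : realType) (rho : R -> R) : Prop :=
  (forall t, 0 <= t -> 0 <= rho t) /\
  (forall s t, 0 <= s -> s <= t -> rho s <= rho t).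

Definition coarse_embedding (R : realType) (X Y : Type)
    (dX : X -> X -> R) (dY : Y -> Y -> R) (f : X -> Y) : Prop :=
  exists rho_m rho_p : R -> R,
    [/\ control_function rho_m, control_function rho_p,
        rho_m t @[t --> +oo] --> +oo
      & forall a b : X,
          rho_m (dX a b) <= dY (f a) (f b) /\
          dY (f a) (f b) <= rho_p (dX a b)].

Definition coarsely_embeds_in_Hilbert (R : realType) (G : graph) : Prop :=
  exists (V : hilbertSpace R) (f : G -> V),
    coarse_embedding (fun x y : G => (gdist x y)%:R : R)
      (fun u v : V => `|u - v|) f.

(* Main.v *)
(* Given maps [fG], [fH] to Hilbert spaces, put on the wreath product the sum of
   two kernels of negative type: [|fG (p k) - fG (q k)|^2] summed over [k], and
   the mean over random functionals [u] of the length of the range of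
   [h |-> <fH h, u>] on the finite set [T] made of [h1], [h2] and the places
   where [p] and [q] differ, for vertices [(p, h1)], [(q, h2)]. Counted with
   integer thresholds, this range is a number of cuts of the wreath product,
   since a half-space [A] of [H] and a configuration [c] outside [A] define the
   set of all [(p, h)] with [h] in [A] and [p = c] outside [A]. Adjacent
   vertices have bounded kernel. If the kernel is bounded, then by Khintchine's
   inequality [T] has bounded diameter, hence bounded size as [H] is uniformly
   locally finite, and the lamps move a bounded distance, so the two vertices
   are close. The functional [u] is a sum of randomly signed vectors of an
   orthonormal basis of the span of finitely many [fH h]; the resulting kernels
   converge along an ultrafilter, and Schoenberg's construction turns the limit
   into a map to a Hilbert space. *)
Require Import Defs.
From HB Require Import structures.
From mathcomp Require Import all_boot all_order all_algebra sesquilinear.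
From mathcomp Require Import all_classical all_reals all_analysis.
From mathcomp Require Import ring lra.

Set Implicit Arguments.
Unset Strict Implicit.
Unset Printing Implicit Defensive.

Import Order.TTheory GRing.Theory Num.Theory.
Import numFieldNormedType.Exports.

Local Open Scope classical_set_scope.
Local Open Scope ring_scope.

(** * Hilbert spaces from kernels of negative type *)

Section JordanVonNeumann.
Variables (R : realType) (V : completeNormedModType R).
Hypothesis parallelogram : forall u v : V,
  `|u + v| ^+ 2 + `|u - v| ^+ 2 = 2 * (`|u| ^+ 2 + `|v| ^+ 2).

Let ip (u v : V) : R := 4^-1 * (`|u + v| ^+ 2 - `|u - v| ^+ 2).

Let ipC u v : ip u v = ip v u.
Proof. by rewrite /ip (addrC u) (distrC u). Qed.

Let ipuu u : ip u u = `|u| ^+ 2.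
Proof.
by have := parallelogram u u; rewrite /ip subrr normr0 expr0n/=; lra.
Qed.

Let ipD u v w : ip (u + v) w = ip u w + ip v w.
Proof.
(* In [p1 - p2 + p3 - p4] the terms with [u] or [v] subtracted cancel by [e5] and [e6]; what remains
   is eight times the claim. *)
have p1 := parallelogram (u + w) v; have p2 := parallelogram (u - w) v.
have p3 := parallelogram (v + w) u; have p4 := parallelogram (v - w) u.
have e1 : u + w + v = u + v + w by rewrite addrAC.
have e2 : u - w + v = u + v - w by rewrite addrAC.
have e3 : v + w + u = u + v + w by rewrite addrAC (addrC v u).
have e4 : v - w + u = u + v - w by rewrite addrAC (addrC v u).
have e5 : `|v + w - u| = `|u - w - v|.
  by rewrite -normrN !opprD !opprK addrC addrA addrAC.
have e6 : `|v - w - u| = `|u + w - v|.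
  by rewrite -normrN !opprD !opprK addrC addrA addrAC.
move: p1 p2 p3 p4; rewrite e1 e2 e3 e4 e5 e6 /ip.
lra.
Qed.

Let ip0 w : ip 0 w = 0.
Proof. by rewrite /ip add0r sub0r normrN subrr mulr0. Qed.

Let ipN u w : ip (- u) w = - ip u w.
Proof. by apply/eqP; rewrite -addr_eq0 -ipD addNr ip0. Qed.

(** A cheap substitute for Cauchy-Schwarz before homogeneity is known; it keeps the defect from
    homogeneity bounded on [0, 1]. *)
Let ip_bound u w : `|ip u w| <= 2^-1 * (`|u| ^+ 2 + `|w| ^+ 2).
Proof.
have := parallelogram u w; rewrite /ip => e.
have a0 := sqr_ge0 `|u + w|; have b0 := sqr_ge0 `|u - w|.
by rewrite ler_norml; lra.
Qed.

(* An additive function that is bounded on [0, 1] and vanishes on the integers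
   is zero: its value at [l] is [1/n] times its value at the fractional part
   of [n * l]. *)
Let ipZ a u w : ip (a *: u) w = a * ip u w.
Proof.
pose h t := ip (t *: u) w - t * ip u w.
pose C := 2^-1 * (`|u| ^+ 2 + `|w| ^+ 2) + `|ip u w|.
have hD s t : h (s + t) = h s + h t.
  by rewrite /h scalerDl ipD mulrDl; lra.
have h1 : h 1 = 0 by rewrite /h scale1r mul1r subrr.
have h0 : h 0 = 0 by rewrite /h scale0r ip0 mul0r subrr.
have hN t : h (- t) = - h t.
  by apply/eqP; rewrite -addr_eq0 -hD addNr h0.
have hMn t n : h (t *+ n) = h t *+ n.
  by elim: n => [|n IH]; rewrite ?mulr0n// !mulrS hD IH.
have hMz t (z : int) : h (t *~ z) = h t *~ z.
  case: z => n; first exact: hMn.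
  by rewrite NegzE !mulrNz hN; congr (- _); exact: hMn.
have hb t : 0 <= t <= 1 -> `|h t| <= C.
  move=> /andP[t0 t1]; rewrite /h /C.
  apply: (le_trans (ler_normB _ _)); apply: lerD.
    apply: (le_trans (ip_bound _ _)).
    rewrite ler_wpM2l// lerD2r normrZ exprMn ger0_norm//.
    by rewrite ler_piMl ?sqr_ge0// expr_le1.
  by rewrite normrM ger0_norm// ler_piMl.
suff : h a = 0 by move/eqP; rewrite subr_eq0 => /eqP.
apply/eqP; rewrite -normr_eq0; apply/eqP/le_anti/andP; split => //.
apply/ler_addgt0Pr => e e0; rewrite add0r.
have C0 : 0 <= C by apply: le_trans (hb 0 _); rewrite ?normr_ge0// lexx ler01.
pose n := (Num.trunc (C / e)).+1.
have Cn : C / e < n%:R by rewrite /n truncnS_gt.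
have n0 : 0 < n%:R :> R by rewrite ltr0n.
pose t := a *+ n - (Num.floor (a *+ n))%:~R.
have ht : h t = h a *+ n by rewrite /t hD hN hMn hMz h1 mul0rz subr0.
have : `|h t| <= C.
  apply: hb; rewrite /t subr_ge0 floor_le_tmp /=.
  by rewrite lerBlDl ltW// -intrD1 floorD1_gt.
rewrite ht normrMn -mulr_natr => hC.
move: Cn; rewrite ltr_pdivrMr// => Cn.
have := le_lt_trans hC Cn; rewrite mulrC ltr_pM2l// => /ltW//.
Qed.

Let ipDr u v w : ip w (u + v) = ip w u + ip w v.
Proof. by rewrite ipC ipD !(ipC w). Qed.

Let ipZr a u w : ip w (a *: u) = a * ip w u.
Proof. by rewrite ipC ipZ ipC. Qed.

HB.instance Definition _ := @isBilinear.Build R V V R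
  ( *%R ) (idfun \; *%R) ip
  (fun w u v => etrans (ipD u (- v) w) (congr1 _ (ipN v w)))
  (fun w u v => etrans (ipDr u (- v) w) (congr1 _ (etrans (ipC _ _)
     (etrans (ipN v w) (congr1 _ (ipC _ _))))))
  (fun w a u => ipZ a u w) (fun w a u => ipZr a u w).

Let ip_herm u v : ip u v = (-1) ^+ false * idfun (ip v u).
Proof. by rewrite expr0 mul1r ipC. Qed.

HB.instance Definition _ := @isHermitianSesquilinear.Build R V false idfun ip
  ip_herm.

Let ip_gt0 u : u != 0 -> 0 < ip u u.
Proof. by move=> u0; rewrite ipuu exprn_gt0// normr_gt0. Qed.

HB.instance Definition _ := @isDotProduct.Build R V ip ip_gt0.

Definition hilbert_of_parallelogram : hilbertSpace R :=
  @HilbertSpace R V (ip : {dot V for idfun}) (fun u => esym (ipuu u)).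

End JordanVonNeumann.

(** * Formal combinations of points and forms of kernels *)

Section CombinationKernel.
Variables (R : realType) (X : Type).
Implicit Types (k : X -> X -> R) (f g : X -> R) (s t : seq (R * X)).

(** A list of pairs [(a, x)] stands for a formal combination of points. Points may repeat, so
    concatenation is addition. *)
Definition comb f s : R := \sum_(p <- s) p.1 * f p.2.

Definition kform k s t : R := comb (fun x => comb (k x) t) s.

Definition scale_comb (a : R) s := [seq (a * p.1, p.2) | p <- s].

Lemma comb1 f x : comb f [:: (1, x)] = f x.
Proof. by rewrite /comb big_seq1 mul1r. Qed.

Lemma comb_cat f s t : comb f (s ++ t) = comb f s + comb f t.
Proof. by rewrite /comb big_cat. Qed.

Lemma comb_scale f a s : comb f (scale_comb a s) = a * comb f s.
Proof.
by rewrite /comb big_map mulr_sumr; apply: eq_bigr => p _; rewrite /= mulrA.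
Qed.

Lemma combD f g s : comb (fun x => f x + g x) s = comb f s + comb g s.
Proof. by rewrite /comb -big_split; apply: eq_bigr => p _; rewrite mulrDr. Qed.

Lemma combZ a f s : comb (fun x => a * f x) s = a * comb f s.
Proof. by rewrite /comb mulr_sumr; apply: eq_bigr => p _; rewrite mulrCA. Qed.

Lemma combC k s t :
  comb (fun x => comb (k x) t) s = comb (fun y => comb (k^~ y) s) t.
Proof.
rewrite /comb; under eq_bigr do rewrite mulr_sumr.
rewrite exchange_big; apply: eq_bigr => q _; rewrite mulr_sumr.
by apply: eq_bigr => p _; rewrite mulrCA.
Qed.

Lemma kform_catl k s t u : kform k (s ++ t) u = kform k s u + kform k t u.
Proof. exact: comb_cat. Qed.

Lemma kform_catr k s t u : kform k u (s ++ t) = kform k u s + kform k u t.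
Proof.
rewrite /kform -combD; congr comb; apply/funext => x; exact: comb_cat.
Qed.

Lemma kform_scalel k a s t : kform k (scale_comb a s) t = a * kform k s t.
Proof. exact: comb_scale. Qed.

Lemma kform_scaler k a s t : kform k s (scale_comb a t) = a * kform k s t.
Proof.
rewrite /kform -combZ; congr comb; apply/funext => x; exact: comb_scale.
Qed.

Lemma kformC k s t : (forall x y, k x y = k y x) -> kform k s t = kform k t s.
Proof.
by move=> ksym; rewrite /kform combC; congr comb; apply/funext => y;
   congr comb; apply/funext => x.
Qed.

Lemma comb_cvg (T : Type) (F : set_system T) (FF : Filter F)
    (u : T -> X -> R) f s :
  (forall x, u t x @[t --> F] --> f x) -> comb (u t) s @[t --> F] --> comb f s.
Proof.
move=> cvf; elim: s => [|p s IH].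
  by rewrite /comb big_nil; under eq_fun do rewrite big_nil; exact: cvg_cst.
rewrite /comb big_cons; under eq_fun do rewrite big_cons.
by apply: cvgD => //; apply: cvgMr; exact: cvf.
Qed.

End CombinationKernel.

(** * The dual of the space of combinations *)

Section KernelDual.
Variables (R : realType) (X : Type) (k : X -> X -> R).
Implicit Types (f g : X -> R) (s : seq (R * X)).

Let q s := Num.sqrt (kform k s s).

(** The dual replaces a completed quotient: it is complete, and its norm is definite even where [q]
    vanishes on nonzero combinations. A functional is stored through its values on points. *)
Definition kbound f C := 0 <= C /\ forall s, `|comb f s| <= C * q s.

Definition kdual_pred : {pred X -> R} := mem [set f | exists C, kbound f C].

Lemma kdual_submod_closed : submod_closed kdual_pred.
Proof.
split.
  apply: mem_set; exists 0; split => // s.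
  by rewrite /comb big1 ?normr0 ?mul0r// => p _; rewrite mulr0.
move=> a f g /set_mem[C [C0 fC]] /set_mem[D [D0 gD]].
apply: mem_set; exists (`|a| * C + D); split => [|s].
  by rewrite addr_ge0// mulr_ge0.
have -> : comb (a *: f + g) s = a * comb f s + comb g s.
  by rewrite -combZ -combD.
by rewrite (le_trans (ler_normD _ _))// mulrDl lerD// normrM -mulrA ler_wpM2l.
Qed.

HB.instance Definition _ := GRing.isSubmodClosed.Build _ _ kdual_pred
  kdual_submod_closed.

Record kdual := KDual { kdual_val :> X -> R; _ : kdual_val \in kdual_pred }.

HB.instance Definition _ := [isSub for kdual_val].
HB.instance Definition _ := gen_eqMixin kdual.
HB.instance Definition _ := gen_choiceMixin kdual.
HB.instance Definition _ := [SubChoice_isSubLmodule of kdual by <:].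

Implicit Types phi psi : kdual.

Definition knorm phi : R := inf [set C | kbound phi C].

Lemma knorm_has_inf phi : has_inf [set C | kbound phi C].
Proof.
case: phi => f /= /[dup] fP /set_mem[C fC]; split; first by exists C.
by exists 0 => D [].
Qed.

Lemma knorm_ge0 phi : 0 <= knorm phi.
Proof. by apply: lb_le_inf => [|C []//]; case: (knorm_has_inf phi). Qed.

Lemma knorm_le phi C : kbound phi C -> knorm phi <= C.
Proof. by move=> h; apply: ge_inf => //; case: (knorm_has_inf phi). Qed.

(** The infimum is attained: divide by [q s] when it is positive; when it is zero, any admissible
    bound already forces [comb phi s] to vanish. *)
Lemma knormP phi s : `|comb phi s| <= knorm phi * q s.
Proof.
have [q0|q0] := ltP 0 (q s); last first.
  have [C [C0 /(_ s)]] := (knorm_has_inf phi).1.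
  have -> : q s = 0 by apply/le_anti; rewrite q0 sqrtr_ge0.
  by rewrite !mulr0.
rewrite -ler_pdivrMr//; apply: lb_le_inf; first by case: (knorm_has_inf phi).
by move=> C [C0 /(_ s)]; rewrite ler_pdivrMr.
Qed.

Lemma comb_kdualD phi psi s :
  comb (phi + psi : kdual) s = comb phi s + comb psi s.
Proof. exact: combD. Qed.

Lemma comb_kdualZ a phi s : comb (a *: phi : kdual) s = a * comb phi s.
Proof. exact: combZ. Qed.

Lemma comb_kdualB phi psi s :
  comb (phi - psi : kdual) s = comb phi s - comb psi s.
Proof. by rewrite comb_kdualD -scaleN1r comb_kdualZ mulN1r. Qed.

Lemma knormD phi psi : knorm (phi + psi) <= knorm phi + knorm psi.
Proof.
apply: knorm_le; split => [|s]; first by rewrite addr_ge0 ?knorm_ge0.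
by rewrite comb_kdualD mulrDl (le_trans (ler_normD _ _))// lerD// knormP.
Qed.

Lemma knormZ_le a phi : knorm (a *: phi) <= `|a| * knorm phi.
Proof.
apply: knorm_le; split => [|s]; first by rewrite mulr_ge0 ?knorm_ge0.
by rewrite comb_kdualZ normrM -mulrA ler_wpM2l// knormP.
Qed.

Lemma knormZ a phi : knorm (a *: phi) = `|a| * knorm phi.
Proof.
apply/le_anti; rewrite knormZ_le/=.
have [->|a0] := eqVneq a 0; first by rewrite normr0 mul0r knorm_ge0.
have := knormZ_le a^-1 (a *: phi); rewrite scalerA mulVf// scale1r normfV.
by rewrite ler_pdivlMl ?normr_gt0.
Qed.

Lemma kdual_le phi x : `|phi x| <= knorm phi * q [:: (1, x)].
Proof. by have := knormP phi [:: (1, x)]; rewrite comb1. Qed.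

Lemma knorm0_eq0 phi : knorm phi = 0 -> phi = 0.
Proof.
move=> phi0; apply: val_inj; apply/funext => x /=.
have := kdual_le phi x; rewrite phi0 mul0r normr_le0 => /eqP ->//.
Qed.

HB.instance Definition _ :=
  Lmodule_isNormed.Build R kdual knormD knormZ knorm0_eq0.

Lemma kdual_normE phi : `|phi| = knorm phi. Proof. by []. Qed.

Lemma kdual_complete (F : set_system kdual) :
  ProperFilter F -> cauchy F -> cvg F.
Proof.
move=> FF /cauchy_ballP Fc.
have Fx x : cvg ((phi : kdual) x @[phi --> F]).
  (* The summand 1 keeps [c] positive when [q] vanishes at [x]. *)
  apply/cauchy_cvgP/cauchy_ballP => e e0; pose c := q [:: (1, x)] + 1.
  have c0 : 0 < c by rewrite ltr_wpDl// sqrtr_ge0.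
  have [[A B] /= [FA FB] AB] := Fc (e / c) (divr_gt0 e0 c0).
  exists ([set y | exists2 phi, A phi & y = phi x],
          [set y | exists2 phi, B phi & y = phi x]) => /=.
    split.
      by apply: filterS FA => phi Ap; exists phi.
    by apply: filterS FB => phi Bp; exists phi.
  move=> [_ _] /= [[phi Ap ->] [psi Bp ->]].
  have := AB (phi, psi) (conj Ap Bp); rewrite /= -!ball_normE /=.
  rewrite kdual_normE ltr_pdivlMr//; apply: le_lt_trans.
  apply: le_trans (kdual_le (phi - psi) x) _.
  by rewrite ler_wpM2l ?knorm_ge0// lerDl.
pose f x := lim ((phi : kdual) x @[phi --> F]).
have cvf s : comb (phi : kdual) s @[phi --> F] --> comb f s.
  by apply: (@comb_cvg _ _ _ _ _ (@kdual_val)) => x; exact: Fx.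
(* Fix [phi] in the Cauchy pair and let [psi] run along [F]. The bound is uniform in [s], hence a
   bound on the norm. *)
have key e : 0 < e -> \forall phi \near F,
    forall s, `|comb (phi : kdual) s - comb f s| <= e * q s.
  move=> e0; have [[A B] /= [FA FB] AB] := Fc e e0.
  apply: filterS FA => phi Ap s.
  have cvs : `|comb phi s - comb (psi : kdual) s| @[psi --> F]
      --> `|comb phi s - comb f s|.
    by apply: cvg_norm; apply: cvgB; [exact: cvg_cst|exact: cvf].
  apply: (cvgr_to_le cvs); apply: filterS FB => psi Bp.
  have := AB (phi, psi) (conj Ap Bp); rewrite /= -ball_normE /= kdual_normE.
  move=> /ltW le_e; have := knormP (phi - psi) s.
  rewrite comb_kdualB => /le_trans; apply.
  by rewrite ler_wpM2r// sqrtr_ge0.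
have fP : f \in kdual_pred.
  apply: mem_set; have [phi phiP] := filter_ex (key 1 ltr01).
  exists (knorm phi + 1); split => [|s]; first by rewrite addr_ge0 ?knorm_ge0.
  rewrite -[comb f s](subrK (comb phi s)) addrC mulrDl.
  by rewrite (le_trans (ler_normD _ _))// lerD ?knormP// distrC phiP.
apply/cvg_ex; exists (KDual fP); apply/cvgrPdist_le => e e0.
apply: filterS (key e e0) => phi phiP; rewrite kdual_normE.
apply: knorm_le; split=> [|s]; first exact: ltW.
by rewrite comb_kdualB distrC phiP.
Qed.

HB.instance Definition _ := Uniform_isComplete.Build kdual kdual_complete.

Hypothesis k_sym : forall x y, k x y = k y x.
Hypothesis k_psd : forall s, 0 <= kform k s s.

Let q2 s : q s ^+ 2 = kform k s s.
Proof. by rewrite sqr_sqrtr. Qed.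

(** With the next lemma this makes the squared norm a Legendre transform, the supremum of the left
    side over [s]. Suprema over two independent combinations can then be added, as the parallelogram
    law requires. *)
Lemma knorm_ge_legendre phi s :
  2 * comb phi s - kform k s s <= knorm phi ^+ 2.
Proof.
have h := le_trans (ler_norm _) (knormP phi s).
have := sqr_ge0 (knorm phi - q s); rewrite sqrrB q2; lra.
Qed.

Lemma kbound_legendre f D :
  (forall s, 2 * comb f s - kform k s s <= D) -> kbound f (Num.sqrt D).
Proof.
move=> fD; split => [|s]; first exact: sqrtr_ge0.
have D0 : 0 <= D by have := fD [::]; rewrite /kform /comb !big_nil; lra.
have fl l : 2 * l * comb f s - l ^+ 2 * kform k s s <= D.
  have := fD (scale_comb l s).
  by rewrite comb_scale kform_scalel kform_scaler !mulrA expr2.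
rewrite -sqrtrM// -sqrtr_sqr ler_sqrt ?mulr_ge0//.
have [Q0|Q0] := ltP 0 (kform k s s).
  (* The multiplier that maximizes the left side of [fl]. *)
  have := fl (comb f s / kform k s s); rewrite -ler_pdivrMr//.
  set L := comb f s; set Q := kform k s s => h.
  have -> : L ^+ 2 / Q = 2 * (L / Q) * L - (L / Q) ^+ 2 * Q.
    by field; rewrite /Q gt_eqF.
  exact: h.
have Q00 : kform k s s = 0 by apply/le_anti; rewrite Q0 k_psd.
have [->|f0] := eqVneq (comb f s) 0; first by rewrite Q00 expr0n mulr0.
(* With [kform k s s = 0] this multiplier would give [2 * (D + 1) <= D]. *)
have := fl ((D + 1) / comb f s).
rewrite Q00 mulr0 subr0 -mulrA divfK//; lra.
Qed.

Let parallelogram_le phi psi :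
  2 * (knorm phi ^+ 2 + knorm psi ^+ 2)
    <= knorm (phi + psi) ^+ 2 + knorm (phi - psi) ^+ 2.
Proof.
set D := leRHS.
(* Add the Legendre bounds for [phi + psi] at s + t and for [phi - psi] at s - t: the mixed terms
   cancel and the variables separate. The supremum is then taken over [s], and afterwards over
   [t]. *)
have h s t : 2 * comb phi s - kform k s s
    <= D / 2 - (2 * comb psi t - kform k t t).
  have := knorm_ge_legendre (phi + psi) (s ++ t).
  have := knorm_ge_legendre (phi - psi) (s ++ scale_comb (-1) t).
  rewrite comb_kdualB comb_kdualD !comb_cat !kform_catl !kform_catr.
  rewrite !comb_scale !kform_scalel !kform_scaler /D; lra.
have sqr_le E phi' : 0 <= E -> knorm phi' <= Num.sqrt E -> knorm phi' ^+ 2 <= E.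
  by move=> E0 le; rewrite -(sqr_sqrtr E0) ler_sqr ?nnegrE ?knorm_ge0 ?sqrtr_ge0.
have e0 f : 2 * comb f [::] - kform k [::] [::] = 0.
  by rewrite /kform /comb !big_nil; lra.
have h1 t : 2 * comb psi t - kform k t t <= D / 2 - knorm phi ^+ 2.
  have := h [::] t; rewrite e0 => ge0.
  have := sqr_le _ _ ge0 (knorm_le (kbound_legendre (h^~ t))); lra.
have := h1 [::]; rewrite e0 => ge0.
have := sqr_le _ _ ge0 (knorm_le (kbound_legendre h1)); lra.
Qed.

Lemma kdual_parallelogram (phi psi : kdual) :
  `|phi + psi| ^+ 2 + `|phi - psi| ^+ 2 = 2 * (`|phi| ^+ 2 + `|psi| ^+ 2).
Proof.
apply/le_anti; rewrite parallelogram_le andbT.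
(* The reverse inequality is the same one for the sum and the difference. *)
have := parallelogram_le (phi + psi) (phi - psi).
have -> : phi + psi + (phi - psi) = 2 *: phi.
  by rewrite addrA [LHS]addrAC addrK scaler_nat mulr2n.
have -> : phi + psi - (phi - psi) = 2 *: psi.
  by rewrite opprB addrC addrA subrK scaler_nat mulr2n.
by rewrite !knormZ ger0_norm// !kdual_normE; lra.
Qed.

(** Cauchy-Schwarz in Legendre form: it expresses that the form is nonnegative at s - t. *)
Lemma kelem_bound t :
  kbound (fun x => comb (k x) t) (Num.sqrt (kform k t t)).
Proof.
apply: kbound_legendre => s; rewrite -/(kform k s t).
have := k_psd (s ++ scale_comb (-1) t).
rewrite kform_catl !kform_catr !kform_scalel !kform_scaler.
rewrite (kformC t s k_sym); lra.
Qed.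

Definition kelem t : kdual :=
  KDual (mem_set (ex_intro _ _ (kelem_bound t)) : _ \in kdual_pred).

Lemma kelem_norm t : `|kelem t| ^+ 2 = kform k t t.
Proof.
apply/le_anti/andP; split; last first.
  have := knorm_ge_legendre (kelem t) t; rewrite kdual_normE.
  rewrite -[comb (kelem t) t]/(kform k t t); lra.
rewrite -(sqr_sqrtr (k_psd t)) ler_sqr ?nnegrE ?sqrtr_ge0//.
exact/knorm_le/kelem_bound.
Qed.

Lemma kelem_dist x y :
  `|kelem [:: (1, x)] - kelem [:: (1, y)]| ^+ 2 = k x x - 2 * k x y + k y y.
Proof.
have -> : kelem [:: (1, x)] - kelem [:: (1, y)] = kelem [:: (1, x); (-1, y)].
  apply: val_inj; apply/funext => z /=.
  rewrite /comb big_cons !big_seq1 /=.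
  rewrite -[LHS]/(comb (k z) [:: (1, x)] - comb (k z) [:: (1, y)]).
  by rewrite !comb1 mul1r mulN1r.
rewrite kelem_norm /kform /comb !big_cons !big_nil /= (k_sym y x).
lra.
Qed.

End KernelDual.

(** * Schoenberg's theorem *)

Section NegativeType.
Variables (R : realType) (X : Type).

Definition negative_type (K : X -> X -> R) :=
  [/\ forall x y, K x y = K y x, forall x, K x x = 0
    & forall s : seq (R * X), \sum_(p <- s) p.1 = 0 -> kform K s s <= 0].

(* Schoenberg's theorem: the Hilbert space is the dual of the space of finite
   combinations of points, normed by the kernel centred at [x0]. *)
Lemma negative_type_embedding (K : X -> X -> R) (x0 : X) : negative_type K ->
  exists (V : hilbertSpace R) (F : X -> V),
    forall x y, `|F x - F y| ^+ 2 = K x y.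
Proof.
move=> [Ksym K0 Kneg].
pose k x y := 2^-1 * (K x x0 + K y x0 - K x y).
have k_sym x y : k x y = k y x by rewrite /k (Ksym x y) (addrC (K x x0)).
have k_psd s : 0 <= kform k s s.
  pose a := \sum_(p <- s) p.1; pose c := comb (K^~ x0) s.
  have combk x : comb (k x) s = 2^-1 * (K x x0 * a + c - comb (K x) s).
    rewrite /c /a /comb /k mulr_sumr -big_split/= -sumrB mulr_sumr.
    by apply: eq_bigr => p _; ring.
  have -> : kform k s s = 2^-1 * (2 * (a * c) - kform K s s).
    rewrite /kform; under [fun x => comb (k x) s]funext do rewrite combk.
    rewrite combZ; congr (_ * _).
    have -> : (fun x => K x x0 * a + c - comb (K x) s) =
        (fun x => (a * K x x0 + c * 1) + -1 * comb (K x) s).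
      by apply/funext => x; ring.
    rewrite combD combD !combZ.
    have -> : comb (fun=> 1) s = a.
      by rewrite /comb /a; apply: eq_bigr => p _; rewrite mulr1.
    rewrite -/c; ring.
  (* The atom at [x0] brings the total coefficient to zero and changes the form only by the cross
     term [- 2 * (a * c)]. *)
  have := Kneg (s ++ [:: (- a, x0)]).
  rewrite big_cat big_seq1/= subrr => /(_ erefl).
  rewrite kform_catl !kform_catr (kformC [:: (- a, x0)] s Ksym).
  have -> : kform K s [:: (- a, x0)] = - (a * c).
    rewrite /kform /c -mulNr -combZ; congr comb.
    by apply/funext => x; rewrite /comb big_seq1.
  have -> : kform K [:: (- a, x0)] [:: (- a, x0)] = 0.
    by rewrite /kform /comb !big_seq1 /= K0 !mulr0.
  lra.
exists (hilbert_of_parallelogram (kdual_parallelogram k_psd)).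
exists (fun x => kelem k_sym k_psd [:: (1, x)]) => x y.
apply: etrans (kelem_dist k_sym k_psd x y) _.
by rewrite /k !K0; lra.
Qed.

End NegativeType.

(** * Graphs and the coarse embedding criterion *)

Section NegativeTypeLimit.
Variables (R : realType) (X : Type).

Lemma negative_type_ge0 (K : X -> X -> R) x y : negative_type K -> 0 <= K x y.
Proof.
move=> [Ksym K0 Kneg]; have := Kneg [:: (1, x); (-1, y)].
rewrite /kform /comb !big_cons !big_nil /= (Ksym y x) !K0.
move=> /(_ _); lra.
Qed.

(** Such a kernel behaves as a squared distance, whence the factor 2. The test combination is the
    second difference x + z - 2y. *)
Lemma negative_type_triangle (K : X -> X -> R) x y z : negative_type K ->
  K x z <= 2 * (K x y + K y z).
Proof.
move=> [Ksym K0 Kneg]; have := Kneg [:: (1, x); (1, z); (-2, y)].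
rewrite /kform /comb !big_cons !big_nil /= (Ksym z x) (Ksym y x) (Ksym z y) !K0.
move=> /(_ _); lra.
Qed.

Lemma negative_type_cvg (T : Type) (F : set_system T) (FF : ProperFilter F)
    (u : T -> X -> X -> R) (K : X -> X -> R) :
  (forall t, negative_type (u t)) ->
  (forall x y, u t x y @[t --> F] --> K x y) -> negative_type K.
Proof.
move=> uneg uK; split => [x y|x|s s0].
- apply: (cvg_unique _ (uK x y)) => //.
  have -> : (fun t => u t x y) = (fun t => u t y x); last exact: uK.
  by apply/funext => t; case: (uneg t).
- apply: (cvg_unique _ (uK x x)) => //.
  have -> : (fun t => u t x x) = (fun=> 0); last exact: cvg_cst.
  by apply/funext => t; case: (uneg t).
- have : kform (u t) s s @[t --> F] --> kform K s s.
    by apply: comb_cvg => x; apply: comb_cvg => y; exact: uK.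
  move=> /cvgr_to_le; apply; apply: nearW => t.
  by case: (uneg t) => _ _; exact.
Qed.

(** The image ultrafilter clusters in the compact segment, and a cluster point of an ultrafilter is
    a limit. *)
Lemma ultrafilter_cvg (T : Type) (U : set_system T) (f : T -> R) (B : R) :
  UltraFilter U -> (forall t, 0 <= f t <= B) -> cvg (f t @[t --> U]).
Proof.
move=> UU fB; have [|p [_ fp]] := @segment_compact R 0 B (f @ U) _.
  by apply: nearW => t; rewrite /= in_itv/= fB.
apply/cvg_ex; exists p => A pA.
have [//|UC] := in_ultra_setVsetC (f @^-1` A) UU.
by have [t []] := fp _ _ (UC : (f @ U) (~` A)) pA.
Qed.

End NegativeTypeLimit.

(** * Walks and the shortest-path distance *)

Section Walks.
Variable G : graph.
Implicit Types x y z : G.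

Lemma walk0 x : walk x x 0.
Proof. by exists [::]. Qed.

Lemma walkS x y z n : adj x y -> walk y z n -> walk x z n.+1.
Proof. by move=> xy [p [p1 p2 p3]]; exists (y :: p); rewrite /= xy p1 p2 p3. Qed.

Lemma walk0_eq x y : walk x y 0 -> x = y.
Proof. by move=> [[|a p] [_ /= ? ?]]. Qed.

Lemma walkS_inv x z n : walk x z n.+1 -> exists2 y, adj x y & walk y z n.
Proof.
by move=> [[|y p] [//= /andP[xy p1] p2 [p3]]]; exists y => //; exists p.
Qed.

Lemma walk1 x y : adj x y -> walk x y 1.
Proof. by move=> xy; apply: walkS xy (walk0 y). Qed.

Lemma walk_cat x y z m n : walk x y m -> walk y z n -> walk x z (m + n).
Proof.
elim: m x => [|m IH] x; first by move=> /walk0_eq ->.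
by move=> /walkS_inv[w xw wy] yz; apply: walkS xw (IH _ wy yz).
Qed.

Lemma walk_sym x y n : walk x y n -> walk y x n.
Proof.
elim: n x => [|n IH] x; first by move=> /walk0_eq ->; exact: walk0.
move=> /walkS_inv[w xw wy]; rewrite -addn1; apply: walk_cat (IH _ wy) _.
by apply: walk1; rewrite adj_sym.
Qed.

Lemma gdist_le x y n : walk x y n -> (gdist x y <= n)%N.
Proof.
rewrite /gdist => w; case: pselect => // ex.
by case: ex_minnP => m _; apply; exact/asboolP.
Qed.

Lemma walk_gdist x y n : walk x y n -> walk x y (gdist x y).
Proof.
rewrite /gdist => w; case: pselect => [ex|[]]; last first.
  by exists n; exact/asboolP.
by case: ex_minnP => m /asboolP.
Qed.

Lemma walk_control (P : nat -> G -> G -> Prop) :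
  (forall x, P 0%N x x) ->
  (forall n x y z, adj x y -> P n y z -> P n.+1 x z) ->
  forall n x y, walk x y n -> P n x y.
Proof.
move=> P0 PS; elim => [|n IH] x y; first by move=> /walk0_eq ->.
by move=> /walkS_inv[w xw wy]; apply: PS xw (IH _ _ wy).
Qed.

End Walks.

(** * Coarse embeddings of graphs through two bounds *)

Section CoarseCriterion.
Variables (R : realType) (G : graph).

(** With its converse below, this trades the control functions for one bound on edges and one on the
    distance between vertices with close images. *)
Lemma coarse_embedding_bounds (V : normedModType R) (f : G -> V) :
  coarse_embedding (fun x y => (gdist x y)%:R : R) (fun u v => `|u - v|) f ->
  (exists2 C, 0 <= C & forall x y, adj x y -> `|f x - f y| <= C) /\
  (forall B, exists M, forall x y, `|f x - f y| <= B -> (gdist x y <= M)%N).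
Proof.
move=> [rm [rp [[rm0 rmi] [rp0 rpi] rmy rmp]]]; split.
  exists (rp 1) => [|x y xy]; first exact: rp0.
  apply: le_trans (rmp x y).2 _; apply: rpi => //.
  by rewrite (ler_nat R _ 1) gdist_le//; exact: walk1.
move=> B; have /cvgryPgt/(_ B)[M [_ MP]] := rmy.
exists (Num.trunc `|M|).+1 => x y fxy; rewrite leqNgt; apply/negP => lt.
have : B < rm (gdist x y)%:R.
  apply: MP; apply: le_lt_trans (ler_norm _) _.
  apply: lt_trans (truncnS_gt _) _; first by rewrite ltr_nat.
by rewrite ltNge (le_trans (rmp x y).1).
Qed.

Lemma coarse_embedding_of_bounds (V : normedModType R) (f : G -> V) :
  connected_graph G ->
  (exists2 C, 0 <= C & forall x y, adj x y -> `|f x - f y| <= C) ->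
  (forall B, exists M, forall x y, `|f x - f y| <= B -> (gdist x y <= M)%N) ->
  coarse_embedding (fun x y => (gdist x y)%:R : R) (fun u v => `|u - v|) f.
Proof.
move=> [_ conn] [C C0 fC] fM.
(* The extra element [t] keeps [S t] nonempty when no two vertices are that far apart, and it still
   lets the infimum tend to infinity. *)
pose S t := [set r | r = t \/ exists2 xy : G * G, t <= (gdist xy.1 xy.2)%:R
  & r = `|f xy.1 - f xy.2|].
have Sinf t : 0 <= t -> has_inf (S t).
  move=> t0; split; first by exists t; left.
  by exists 0 => r [->//|[xy _ ->]].
exists (fun t => inf (S t)), (fun t => C * t); split.
- split => [t t0|s t s0 st].
    apply: lb_le_inf; first exact: (Sinf t t0).1.
    by move=> r [->//|[xy _ ->]].
  have t0 := le_trans s0 st.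
  apply: lb_le_inf; first exact: (Sinf t t0).1.
  move=> r [->|[xy le ->]].
    by apply: le_trans st; apply: ge_inf; [exact: (Sinf s s0).2|left].
  apply: ge_inf; first exact: (Sinf s s0).2.
  by right; exists xy => //; exact: le_trans le.
- by split => [t t0|s t s0 st]; rewrite ?mulr_ge0// ler_wpM2l.
- apply/cvgryPge => A; have [M MP] := fM A.
  near=> t; apply: lb_le_inf; first by exists t; left.
  move=> r [->|[[x y] /= le ->]].
    by near: t; apply: nbhs_pinfty_ge; exact: num_real.
  rewrite leNgt; apply/negP => /ltW /MP; rewrite -(ler_nat R) => leM.
  have : t <= M%:R by exact: le_trans le leM.
  by apply/negP; rewrite -ltNge; near: t; apply: nbhs_pinfty_gt; exact: num_real.
- move=> x y; split.
    by apply: ge_inf; [exact: (Sinf _ (ler0n _ _)).2|right; exists (x, y)].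
  have [n /walk_gdist] := conn x y.
  apply: (@walk_control _ (fun n x y => `|f x - f y| <= C * n%:R)).
    by move=> z; rewrite subrr normr0 mulr0.
  move=> m a b c ab bc; rewrite -[f a - f c](subrKA (f b)).
  rewrite (le_trans (ler_normD _ _))// -natr1 mulrDr mulr1 addrC lerD//.
  exact: fC.
Unshelve. all: by end_near. Qed.

(** The kernels need not converge. An ultrafilter finer than [\oo] supplies a limit kernel, and an
    inequality that holds eventually for a pair of vertices passes to that limit. *)
Lemma coarsely_embeds_of_limit (K : nat -> G -> G -> R) :
  connected_graph G -> (forall N, negative_type (K N)) ->
  (exists C, forall N x y, adj x y -> K N x y <= C) ->
  (forall B, exists M, forall x y, (M < gdist x y)%N ->
    \forall N \near \oo, B <= K N x y) ->
  coarsely_embeds_in_Hilbert R G.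
Proof.
move=> Gc Kneg [C KC] Kproper; have [[x0] conn] := Gc.
have [U [UU ooU]] := @ultraFilterLemma _ \oo _.
(* The bound may grow exponentially with the length of a walk; only its independence of [N]
   matters. *)
have Kbound x y : exists B, forall N, 0 <= K N x y <= B.
  have [n w] := conn x y.
  suff [B KB] : exists B, forall N, K N x y <= B.
    by exists B => N; rewrite KB negative_type_ge0.
  move: w.
  apply: (@walk_control _ (fun _ x y => exists B, forall N, K N x y <= B)).
    by move=> z; exists 0 => N; case: (Kneg N) => _ ->.
  move=> m a b c ab [B KB]; exists (2 * (C + B)) => N.
  apply: (le_trans (negative_type_triangle a b c (Kneg N))).
  by rewrite ler_wpM2l// lerD// KC.
pose L x y := lim (K N x y @[N --> U]).
have KL x y : K N x y @[N --> U] --> L x y.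
  by have [B KB] := Kbound x y; have := ultrafilter_cvg UU KB; exact.
have [V [F FL]] := negative_type_embedding x0 (negative_type_cvg _ Kneg KL).
exists V, F; apply: coarse_embedding_of_bounds => //.
  exists (`|C| + 1) => [|x y xy]; first by rewrite addr_ge0.
  have : L x y <= `|C|.
    apply: (cvgr_to_le (KL x y)); apply: nearW => N.
    by apply: le_trans (KC _ _ _ xy) (ler_norm _).
  rewrite -FL; have := normr_ge0 (F x - F y); nra.
move=> B; have [M MP] := Kproper (B ^+ 2 + 1).
exists M => x y FB; rewrite leqNgt; apply/negP => /MP ge.
have : B ^+ 2 + 1 <= L x y by apply: (cvgr_to_ge (KL x y)); exact: ooU.
rewrite -FL; have := normr_ge0 (F x - F y); nra.
Qed.

End CoarseCriterion.

(** * Averaging cut kernels over random signs *)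

Section NegativeTypeOperations.
Variables (R : realType) (X : Type).
Implicit Types (K : X -> X -> R) (s : seq (R * X)).

Lemma kformD K1 K2 s t :
  kform (fun x y => K1 x y + K2 x y) s t = kform K1 s t + kform K2 s t.
Proof. by rewrite /kform -combD; congr comb; apply/funext => x; exact: combD. Qed.

Lemma kformZ a K s t : kform (fun x y => a * K x y) s t = a * kform K s t.
Proof. by rewrite /kform -combZ; congr comb; apply/funext => x; exact: combZ. Qed.

Lemma negative_type0 : negative_type (fun _ _ : X => 0 : R).
Proof.
split => // s _; rewrite /kform /comb big1// => p _.
by rewrite big1 ?mulr0// => q _; rewrite mulr0.
Qed.

Lemma negative_typeD K1 K2 : negative_type K1 -> negative_type K2 ->
  negative_type (fun x y => K1 x y + K2 x y).
Proof.
move=> [s1 z1 n1] [s2 z2 n2]; split => [x y|x|s s0].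
- by rewrite s1 s2.
- by rewrite z1 z2 addr0.
- by rewrite kformD; have := n1 s s0; have := n2 s s0; lra.
Qed.

Lemma negative_typeZ a K : 0 <= a -> negative_type K ->
  negative_type (fun x y => a * K x y).
Proof.
move=> a0 [Ks Kz Kn]; split => [x y|x|s s0]; first by rewrite Ks.
- by rewrite Kz mulr0.
- by rewrite kformZ mulr_ge0_le0// Kn.
Qed.

Lemma negative_type_sum (K : nat -> X -> X -> R) n :
  (forall j, negative_type (K j)) ->
  negative_type (fun x y => \sum_(j < n) K j x y).
Proof.
move=> Kn; elim: n => [|n IH].
  rewrite (_ : (fun x y => _) = (fun _ _ => 0)); first exact: negative_type0.
  by apply/funext => x; apply/funext => y; rewrite big_ord0.
rewrite (_ : (fun x y => _) =
    (fun x y => \sum_(j < n) K j x y + K n x y)); first exact: negative_typeD.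
by apply/funext => x; apply/funext => y; rewrite big_ord_recr.
Qed.

(** Grouping the terms by the common value [c] turns the form into a sum of squares of class
    totals. *)
Lemma equality_kernel_ge0 (T : eqType) (s : seq (R * T)) :
  0 <= \sum_(p <- s) p.1 * (\sum_(q <- s) q.1 * (p.2 == q.2)%:R).
Proof.
pose l := undup [seq p.2 | p <- s].
suff -> : \sum_(p <- s) p.1 * (\sum_(q <- s) q.1 * (p.2 == q.2)%:R) =
    \sum_(c <- l) (\sum_(p <- s) p.1 * (p.2 == c)%:R) ^+ 2.
  by apply: sumr_ge0 => c _; exact: sqr_ge0.
under [RHS]eq_bigr do rewrite expr2 mulr_suml.
rewrite exchange_big; apply: eq_big_seq => p ps /=.
under [RHS]eq_bigr do rewrite -mulrA.
rewrite -mulr_sumr; congr (_ * _).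
rewrite (bigD1_seq p.2) ?undup_uniq ?mem_undup ?map_f//= eqxx mul1r.
rewrite [X in _ + X]big1 ?addr0 => [|c /negPf pc]; last first.
  by rewrite eq_sym pc mul0r.
by apply: eq_bigr => q _; rewrite eq_sym.
Qed.

(* The number of the sets [{x | P x /\ lab x = c}], [c : T], that contain
   exactly one of [x] and [y]. *)
Definition cut_kernel (T : Type) (P : X -> bool) (lab : X -> T) (x y : X) : R :=
  (P x)%:R + (P y)%:R - 2 * (P x && P y && `[< lab x = lab y >])%:R.

(** Terms depending on one point only vanish on combinations of total zero. The rest is -2 times the
    equality form of the labels, weighted by [P]. *)
Lemma cut_kernel_negative_type (T : Type) (P : X -> bool) (lab : X -> T) :
  negative_type (cut_kernel P lab).
Proof.
split => [x y|x|s s0].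
- rewrite /cut_kernel [X in X - _]addrC (andbC (P x)).
  by congr (_ - 2 * (_ && _)%:R); apply: asbool_equiv_eq; split.
- by rewrite /cut_kernel asboolT// andbT andbb; lra.
pose lb x : {classic T} := lab x.
pose J x y : R := (P x)%:R * ((P y)%:R * (lb x == lb y)%:R).
have -> : cut_kernel P lab =
    (fun x y => ((P x)%:R + (P y)%:R) + (-2) * J x y).
  apply/funext => x; apply/funext => y; rewrite /cut_kernel /J mulNr.
  have -> : `[< lab x = lab y >] = (lb x == lb y).
    by apply/idP/idP => [/asboolP xy|/eqP xy]; [exact/eqP|exact/asboolP].
  by rewrite -!natrM !mulnb andbA.
rewrite kformD kformZ kformD.
have -> : kform (fun x _ => (P x)%:R) s s = 0.
  rewrite /kform /comb big1// => p _; rewrite -mulr_suml s0 mul0r mulr0//.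
have -> : kform (fun _ y => (P y)%:R) s s = 0.
  by rewrite /kform /comb -mulr_suml s0 mul0r.
have := equality_kernel_ge0 [seq (p.1 * (P p.2)%:R, lb p.2) | p <- s].
rewrite big_map; under eq_bigr do rewrite big_map.
suff -> : kform J s s = \sum_(j <- s)
     (j.1 * (P j.2)%:R, lb j.2).1 *
     (\sum_(j0 <- s)
         (j0.1 * (P j0.2)%:R, lb j0.2).1 *
         ((j.1 * (P j.2)%:R, lb j.2).2 == (j0.1 * (P j0.2)%:R, lb j0.2).2)%:R).
  lra.
apply: eq_bigr => p _ /=; rewrite -mulrA; congr (_ * _).
by rewrite mulr_sumr /comb; apply: eq_bigr => q _ /=; rewrite /J; ring.
Qed.

Lemma sqr_dist_negative_type (V : hilbertSpace R) (f : X -> V) :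
  negative_type (fun x y => `|f x - f y| ^+ 2).
Proof.
split => [x y|x|s s0]; first by rewrite distrC.
- by rewrite subrr normr0 expr0n.
pose w := \sum_(p <- s) p.1 *: f p.2.
have ipD u : inner V u w = comb (fun y => inner V u (f y)) s.
  by rewrite /w linear_sumr; apply: eq_bigr => p _; rewrite linearZr.
have -> : (fun x y => `|f x - f y| ^+ 2) =
    (fun x y => (`|f x| ^+ 2 + `|f y| ^+ 2) + (-2) * inner V (f x) (f y)).
  apply/funext => x; apply/funext => y.
  by rewrite !inner_norm (hnormB (inner V)) /= expr0 mul1r; ring.
rewrite kformD kformZ kformD.
have -> : kform (fun x _ => `|f x| ^+ 2) s s = 0.
  by rewrite /kform /comb big1// => p _; rewrite -mulr_suml s0 mul0r mulr0.
have -> : kform (fun _ y => `|f y| ^+ 2) s s = 0.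
  by rewrite /kform /comb -mulr_suml s0 mul0r.
have -> : kform (fun x y => inner V (f x) (f y)) s s = inner V w w.
  rewrite ipD /kform; congr comb; apply/funext => x.
  by rewrite -ipD (hermC (inner V)) expr0 mul1r.
by rewrite -inner_norm; have := sqr_ge0 `|w|; lra.
Qed.

End NegativeTypeOperations.

(** * Moments of random sign sums and Khintchine's inequality *)

Section SignMean.
Variables (R : realType) (V : normedModType R).
Implicit Types (b : seq V) (g h : V -> R) (L : {additive V -> R}).

(* The mean of [g (+- e_1 +- ... +- e_n)] over all choices of signs. *)
Fixpoint signmean b g : R :=
  if b is e :: b' then
    2^-1 * (signmean b' (fun u => g (u + e)) + signmean b' (fun u => g (u - e)))
  else g 0.

(** Sign sums have norm at most the sum of the norms. This a priori bound is what later lets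
    finitely many thresholds suffice. *)
Lemma le_signmean b g h :
  (forall u, `|u| <= \sum_(e <- b) `|e| -> g u <= h u) ->
  signmean b g <= signmean b h.
Proof.
elim: b g h => [|e b IH] g h gh /=; first by rewrite gh// normr0 big_nil.
rewrite ler_wpM2l ?invr_ge0// lerD// IH// => u ub; apply: gh.
  by rewrite big_cons (le_trans (ler_normD _ _))// addrC lerD2l.
by rewrite big_cons (le_trans (ler_normD _ _))// normrN addrC lerD2l.
Qed.

Lemma signmeanD b g h :
  signmean b (fun u => g u + h u) = signmean b g + signmean b h.
Proof. by elim: b g h => [//|e b IH] g h /=; rewrite !IH; ring. Qed.

Lemma signmeanZ b a g : signmean b (fun u => a * g u) = a * signmean b g.
Proof. by elim: b g => [//|e b IH] g /=; rewrite !IH; ring. Qed.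

Lemma signmean_cst b a : signmean b (fun=> a) = a.
Proof. by elim: b => [//|e b IH] /=; rewrite !IH; field. Qed.

Lemma signmean_additive b L : signmean b L = 0.
Proof.
elim: b => [|e b IH] /=; first by rewrite raddf0.
under eq_fun do rewrite raddfD.
under [in X in _ + X]eq_fun do rewrite raddfB.
by rewrite !signmeanD IH !signmean_cst; ring.
Qed.

Lemma signmean_sqr b L :
  signmean b (fun u => L u ^+ 2) = \sum_(e <- b) L e ^+ 2.
Proof.
elim: b => [|e b IH] /=; first by rewrite raddf0 big_nil expr0n.
rewrite -signmeanD big_cons -IH.
have -> : (fun u => L (u + e) ^+ 2 + L (u - e) ^+ 2) =
    (fun u => 2 * L u ^+ 2 + 2 * L e ^+ 2).
  by apply/funext => u; rewrite raddfD raddfB; ring.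
by rewrite signmeanD signmeanZ signmean_cst; field.
Qed.

(** Odd terms cancel at each new sign, and the mixed term, with its coefficient 6, is exactly the
    one in three times the expanded square. *)
Lemma signmean_exp4 b L :
  signmean b (fun u => L u ^+ 4) <= 3 * (\sum_(e <- b) L e ^+ 2) ^+ 2.
Proof.
elim: b => [|e b IH] /=; first by rewrite raddf0 big_nil !expr0n mulr0.
rewrite -signmeanD big_cons.
have -> : (fun u => L (u + e) ^+ 4 + L (u - e) ^+ 4) =
    (fun u => 2 * L u ^+ 4 + (12 * L e ^+ 2 * L u ^+ 2 + 2 * (L e ^+ 2) ^+ 2)).
  by apply/funext => u; rewrite raddfD raddfB; ring.
rewrite !signmeanD !signmeanZ signmean_cst signmean_sqr.
have := sqr_ge0 (L e ^+ 2); move: IH.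
set S := \sum_(_ <- _) _; set A := signmean _ _.
lra.
Qed.

(** The positive part is half of [L u + |L u|], and [L] has mean zero. The absolute value is bounded
    below by t^2/r - t^4/r^3, whose mean is controlled by the second and fourth moments. *)
Lemma khintchine b L (s : R) : 0 <= s -> s ^+ 2 = \sum_(e <- b) L e ^+ 2 ->
  s / 9 <= signmean b (fun u => Num.max 0 (L u)).
Proof.
rewrite le_eqVlt => /predU1P[<- _|s0 sE].
  rewrite mul0r -[leLHS](signmean_cst b); apply: le_signmean => u _.
  by rewrite le_max lexx.
(* This [r] maximizes s^2/r - 3 s^4/r^3; the maximum is 2s/9, and half of it is the stated bound. *)
pose r := 3 * s; have r0 : 0 < r by rewrite mulr_gt0.
pose g u : R := 2^-1 * L u + ((2 * r)^-1 * L u ^+ 2 +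
  (- (2 * r ^+ 3)^-1) * L u ^+ 4).
have : signmean b g <= signmean b (fun u => Num.max 0 (L u)).
  apply: le_signmean => u _; rewrite /g; set x := L u.
  have key (t : R) : 0 <= t -> t ^+ 2 / r - t ^+ 4 / r ^+ 3 <= t.
    move=> t0; rewrite -subr_ge0.
    have -> : t - (t ^+ 2 / r - t ^+ 4 / r ^+ 3) =
        t / r ^+ 3 * (r ^+ 3 - r ^+ 2 * t + t ^+ 3).
      by field; rewrite gt_eqF.
    apply: mulr_ge0; first by rewrite divr_ge0// exprn_ge0// ltW.
    have [tr|/ltW tr] := leP t r.
      have : 0 <= r ^+ 2 * (r - t) by rewrite mulr_ge0 ?sqr_ge0// subr_ge0.
      have : 0 <= t ^+ 3 by rewrite exprn_ge0.
      lra.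
    have : 0 <= t * (t - r) * (t + r).
      by rewrite !mulr_ge0 ?subr_ge0// addr_ge0// ltW.
    have : 0 < r ^+ 3 by rewrite exprn_gt0.
    lra.
  have e2 : (2 * r)^-1 * x ^+ 2 + - (2 * r ^+ 3)^-1 * x ^+ 4 =
      2^-1 * (x ^+ 2 / r - x ^+ 4 / r ^+ 3) by field; rewrite gt_eqF.
  rewrite e2; have [x0|x0] := leP 0 x.
    by have := key x x0; lra.
  have := key (- x); rewrite sqrrN (_ : (- x) ^+ 4 = x ^+ 4); last by ring.
  by rewrite oppr_ge0 => /(_ (ltW x0)); lra.
rewrite /g !signmeanD !signmeanZ signmean_additive signmean_sqr -sE => h.
apply: le_trans h; have := signmean_exp4 b L; rewrite -sE.
set A := signmean _ _ => h4.
have c0 : 0 <= (2 * r ^+ 3)^-1 by rewrite invr_ge0 mulr_ge0// exprn_ge0// ltW.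
have := ler_wpM2l c0 h4.
have -> : s / 9 = (2 * r)^-1 * s ^+ 2 -
    (2 * r ^+ 3)^-1 * (3 * (s ^+ 2) ^+ 2) by rewrite /r; field; rewrite gt_eqF.
lra.
Qed.

Lemma negative_type_signmean (X : Type) b (K : V -> X -> X -> R) :
  (forall u, negative_type (K u)) ->
  negative_type (fun x y => signmean b (fun u => K u x y)).
Proof.
elim: b K => [|e b IH] K Kn /=; first exact: Kn.
apply: (@negative_typeZ _ _ 2^-1 (fun x y =>
  signmean b (fun u => K (u + e) x y) + signmean b (fun u => K (u - e) x y))).
  by rewrite invr_ge0.
apply: negative_typeD.
  exact: (IH (fun u => K (u + e))).
exact: (IH (fun u => K (u - e))).
Qed.

End SignMean.

(** * Counting integer thresholds *)

Section ThresholdCount.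
Variable R : realType.

(** For [t >= 0] this is the minimum of [n] and floor(t) + 1: a positive part, up to rounding and
    truncation, written as a sum of indicators of half-lines so that it counts cuts. *)
Definition threshold_count (n : nat) (t : R) : R :=
  \sum_(j < n) (j%:R <= t)%R%:R.

Lemma threshold_countS n t : 0 <= t ->
  threshold_count n.+1 t = 1 + threshold_count n (t - 1).
Proof.
move=> t0; rewrite /threshold_count big_ord_recl t0; congr (_ + _).
by apply: eq_bigr => j _; rewrite lerBrDr natr1.
Qed.

Lemma threshold_count_ge0 n t : 0 <= threshold_count n t.
Proof. by apply: sumr_ge0 => j _; exact: ler0n. Qed.

Lemma threshold_count_lt0 n t : t < 0 -> threshold_count n t = 0.
Proof.
move=> t0; rewrite /threshold_count big1// => j _.
by rewrite leNgt (lt_le_trans t0).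
Qed.

Lemma threshold_count_le_size n t : threshold_count n t <= n%:R.
Proof.
rewrite -[n in leRHS]card_ord -sum1_card natr_sum.
by apply: ler_sum => j _; rewrite -[1]/(1%:R) ler_nat leq_b1.
Qed.

Lemma threshold_count_le n t : 0 <= t -> threshold_count n t <= t + 1.
Proof.
elim: n t => [|n IH] t t0; first by rewrite /threshold_count big_ord0; lra.
rewrite threshold_countS//; have [/IH|/threshold_count_lt0->] := leP 0 (t - 1);
  lra.
Qed.

Lemma threshold_count_ge n t : t <= n%:R -> t <= threshold_count n t.
Proof.
elim: n t => [|n IH] t tn; first by rewrite /threshold_count big_ord0.
have [t0|t0] := leP 0 t; last by have := threshold_count_ge0 n.+1 t; lra.
rewrite threshold_countS//.
have := IH (t - 1); rewrite -natr1 in tn; rewrite lerBlDr => /(_ tn); lra.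
Qed.

Lemma threshold_countB n s t :
  s <= t -> threshold_count n t - threshold_count n s <= t - s + 1.
Proof.
move=> st; have [t0|/threshold_count_lt0->] := leP 0 t; last first.
  by have := threshold_count_ge0 n s; lra.
have := threshold_count_le n t0; have [s0|s0] := leP s 0.
  by have := threshold_count_ge0 n s; lra.
have [sn|sn] := leP s n%:R; first by have := threshold_count_ge sn; lra.
(* Here [s] exceeds [n], so both counts are saturated. *)
have := threshold_count_le_size n t; have := threshold_count_ge (lexx n%:R).
have : threshold_count n n%:R <= threshold_count n s.
  apply: ler_sum => j _; have -> : j%:R <= s.
    by rewrite (le_trans _ (ltW sn))// ler_nat ltnW.
  by rewrite ler_nat leq_b1.
lra.
Qed.

End ThresholdCount.

(** * Walks in wreath products *)

Section Retract.
Variables (R : realType) (X Y : graph) (i : X -> Y) (p : Y -> X).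

(** Since [i] preserves edges and [p] maps each edge to an edge or a vertex, [i] is isometric. *)
Lemma coarsely_embeds_of_retract : connected_graph X ->
  (forall x, p (i x) = x) ->
  (forall x y, adj x y -> adj (i x) (i y)) ->
  (forall u v, adj u v -> p u = p v \/ adj (p u) (p v)) ->
  coarsely_embeds_in_Hilbert R Y -> coarsely_embeds_in_Hilbert R X.
Proof.
move=> [_ conn] pi iadj padj [V [F [rm [rp [rm0 rp0 rmy FP]]]]].
exists V, (F \o i), rm, rp; split => // x y.
suff -> : gdist x y = gdist (i x) (i y) by exact: FP.
have iwalk n x' y' : walk x' y' n -> walk (i x') (i y') n.
  apply: (@walk_control _ (fun n x y => walk (i x) (i y) n)).
    by move=> z; exact: walk0.
  by move=> m a b c ab; apply: walkS; exact: iadj.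
have pwalk n u v : walk u v n -> exists2 m, (m <= n)%N & walk (p u) (p v) m.
  apply: (@walk_control _
    (fun n u v => exists2 m, (m <= n)%N & walk (p u) (p v) m)).
    by move=> z; exists 0%N => //; exact: walk0.
  move=> m a b c ab [l lm w]; have [->|pab] := padj _ _ ab.
    by exists l => //; exact: leqW.
  by exists l.+1 => //; exact: walkS w.
have [n /walk_gdist w] := conn x y.
apply/eqP; rewrite eqn_leq (gdist_le (iwalk _ _ _ w)) andbT.
have [m mn] := pwalk _ _ _ (walk_gdist (iwalk _ _ _ w)).
by rewrite !pi => /gdist_le/leq_trans; exact.
Qed.

End Retract.

(** * Balls in a graph of bounded degree *)

Section Balls.
Variables (H : graph) (d : nat).
Hypothesis deg_le : forall x : H, ([set y : H | adj x y] #<= `I_d)%card.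

Lemma neighbour_enumeration : exists c : H -> nat -> H,
  forall x y, adj x y -> exists2 i, (i < d)%N & c x i = y.
Proof.
suff : forall x : H, exists g : nat -> H,
    forall y, adj x y -> exists2 i, (i < d)%N & g i = y.
  by move=> /choice[c cP]; exists c.
move=> x; have /pcard_leP[g] := deg_le x.
exists (fun i => @xget {classic H} x [set y | adj x y /\ g y = i]) => y xy.
have gy : (g y < d)%N by have /(_ _ xy) := @funS _ _ _ _ g.
exists (g y) => //; case: xgetP => [z _ [xz gz]|/(_ y)[]//].
by apply: (@inj _ _ _ g); rewrite ?inE.
Qed.

(** Each round appends [d] candidate neighbours of every listed vertex. Repetitions are kept, which
    makes the length exact. *)
Lemma ball_enumeration : exists B : nat -> H -> seq {classic H},
  (forall r x, size (B r x) = d.+1 ^ r)%N /\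
  (forall r x y n, (n <= r)%N -> walk x y n -> (y : {classic H}) \in B r x).
Proof.
have [c cP] := neighbour_enumeration.
pose step (s : seq {classic H}) : seq {classic H} :=
  s ++ [seq (c y j : {classic H}) | y <- s, j <- iota 0 d].
pose B r (x : H) := iter r step [:: (x : {classic H})].
exists B; split => [|r x y n].
  elim=> [//|r IH] x; rewrite /B iterS -/(B r x) /step size_cat size_allpairs.
  by rewrite IH size_iota expnS mulSn mulnC.
elim: r x y n => [|r IH] x y [|n] // nr.
- by move=> /walk0_eq ->; rewrite inE.
- by move=> w; rewrite /B iterS -/(B r x) mem_cat (IH _ _ 0%N).
move=> /walk_sym/walkS_inv[z yz /walk_sym xz].
have [j jd jz] := cP z y (etrans (adj_sym _ _) yz).
rewrite /B iterS -/(B r x) mem_cat; apply/orP; right.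
rewrite -jz; apply: (@allpairs_f {classic H} _ {classic H} c).
  exact: (IH _ _ n).
by rewrite mem_iota.
Qed.

(** The balls around one vertex exhaust [H], and a pair of a radius and a position is coded by an
    integer. [e] may repeat vertices; [idx] chooses one index for each. *)
Lemma vertex_enumeration : connected_graph H ->
  exists (e : nat -> H) (idx : H -> nat), cancel idx e.
Proof.
move=> [[x0] conn]; have [B [_ BP]] := ball_enumeration.
pose e n := if unpickle n is Some (r, i) then
  nth (x0 : {classic H}) (B r x0) i else x0.
exists e; suff /choice[idx] : forall x, exists n, e n = x by exists idx.
move=> x; have [n w] := conn x0 x.
exists (pickle (n, index (x : {classic H}) (B n x0))).
by rewrite /e pickleK nth_index// (BP _ _ _ n).
Qed.

End Balls.

(** * Changing lamps by walks, and the two retractions *)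

Section WreathWalks.
Variables (G : graph) (o : G) (H : graph).
Implicit Types (p q : lamp_config o H) (h k : H).

Lemma lamp_ext p q : (forall k, sval p k = sval q k) -> p = q.
Proof.
move=> /funext; case: p q => [f fP] [g gP] /= fg; subst g.
by congr exist; exact: Prop_irrelevance.
Qed.

Lemma lamp_off_finite : finite_set [set k : H | o <> o].
Proof. by rewrite (_ : [set k | _] = set0)// -subset0 => k. Qed.

Definition lamp_off : lamp_config o H := exist _ (fun=> o) lamp_off_finite.

Definition lamp_fun (f : H -> G) h (g : G) k : G :=
  if pselect (k = h) then g else f k.

Lemma lamp_set_finite p h g :
  finite_set [set k | lamp_fun (sval p) h g k <> o].
Proof.
apply: (@sub_finite_set _ _ ([set k | sval p k <> o] `|` [set h])).
  by move=> k; rewrite /lamp_fun /=; case: pselect => kh; [right|left].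
by rewrite finite_setU; split; [exact: (proj2_sig p)|exact: finite_set1].
Qed.

Definition lamp_set p h g : lamp_config o H :=
  exist (fun f : H -> G => finite_set [set k | f k <> o]) _
    (lamp_set_finite p h g).

Lemma lamp_setE p h g : sval (lamp_set p h g) h = g.
Proof. by rewrite /= /lamp_fun; case: pselect. Qed.

Lemma lamp_setNE p h g k : k <> h -> sval (lamp_set p h g) k = sval p k.
Proof. by rewrite /= /lamp_fun; case: pselect. Qed.

Lemma wreath_walk_move p h h' n :
  walk h h' n -> walk ((p, h) : wreath o H) (p, h') n.
Proof.
apply: (@walk_control _ (fun n h h' => walk ((p, h) : wreath o H) (p, h') n)).
  by move=> k; exact: walk0.
by move=> m a b c ab; apply: walkS; apply/asboolP; left.
Qed.

Lemma wreath_walk_lamp n p q h : (forall k, k <> h -> sval p k = sval q k) ->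
  walk (sval p h) (sval q h) n -> walk ((p, h) : wreath o H) (q, h) n.
Proof.
elim: n p => [|n IH] p pq.
  move=> /walk0_eq pqh; rewrite (_ : p = q); first exact: walk0.
  by apply: lamp_ext => k; have [->//|/pq] := pselect (k = h).
move=> /walkS_inv[g pg gq]; apply: (@walkS (wreath o H) _ (lamp_set p h g, h)).
  apply/asboolP; right; split => [//|k /lamp_setNE ->//|].
  by rewrite -(lamp_setE p h g) in pg.
by apply: IH; rewrite ?lamp_setE// => k kh; rewrite lamp_setNE// pq.
Qed.

(** For each listed place the walk goes there from [h], changes the lamp and returns, at cost at
    most [r + s + r]. Returning to [h] keeps the radius [r] valid for the next place. *)
Lemma wreath_walk_list (L : seq {classic H}) p q h r s :
  (forall k, sval p k <> sval q k -> (k : {classic H}) \in L) ->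
  (forall k : {classic H}, k \in L -> exists2 n, (n <= r)%N & walk h k n) ->
  (forall k : {classic H}, k \in L ->
    exists2 n, (n <= s)%N & walk (sval p k) (sval q k) n) ->
  exists2 n, (n <= size L * (r + s + r))%N & walk ((p, h) : wreath o H) (q, h) n.
Proof.
elim: L p => [|k L IH] p pqL Lr Ls.
  exists 0%N => //; rewrite (_ : p = q); first exact: walk0.
  by apply: lamp_ext => k; apply: contrapT => /pqL.
pose p' := lamp_set p k (sval q k).
have [n nL w] : exists2 n, (n <= size L * (r + s + r))%N &
    walk ((p', h) : wreath o H) (q, h) n.
  apply: IH => [k'|k' k'L|k' k'L].
  - have [->|k'k] := pselect (k' = k); first by rewrite lamp_setE.
    rewrite lamp_setNE// => /pqL; rewrite inE => /orP[/eqP//|//].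
  - by apply: Lr; rewrite inE k'L orbT.
  - have [->|k'k] := pselect (k' = k).
      by exists 0%N => //; rewrite lamp_setE; exact: walk0.
    by rewrite lamp_setNE//; apply: Ls; rewrite inE k'L orbT.
have [a ar hk] := Lr k (mem_head _ _).
have [b bs wk] := Ls k (mem_head _ _).
exists (a + b + a + n)%N; first by rewrite /= mulSn !leq_add.
apply: walk_cat w; apply: walk_cat; last first.
  by apply: walk_sym; apply: wreath_walk_move hk.
apply: walk_cat (wreath_walk_move p hk) _.
by apply: wreath_walk_lamp => [k' k'k|]; rewrite /p' ?lamp_setE// lamp_setNE.
Qed.

Lemma wreath_connected :
  connected_graph G -> connected_graph H -> connected_graph (wreath o H).
Proof.
move=> [_ Gc] [[h0] Hc]; split; first by exists; exact: (lamp_off, h0).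
move=> [p h] [q h'].
have /(@finite_seqP {classic H})[L LE] :
    finite_set [set k | sval p k <> sval q k].
  apply: (@sub_finite_set _ _
    ([set k | sval p k <> o] `|` [set k | sval q k <> o])).
    move=> k pq; have [ko|] := pselect (sval p k = o); last by left.
    by right => qo; apply: pq; rewrite ko qo.
  by rewrite finite_setU; split; [exact: (proj2_sig p)|exact: (proj2_sig q)].
pose r := (\max_(k <- L) gdist h k)%N.
pose s := (\max_(k <- L) gdist (sval p k) (sval q k))%N.
have [||| n _ w] := @wreath_walk_list L p q h r s.
- by move=> k pq; have : [set` L] k by rewrite -LE.
- move=> k kL; have [n /walk_gdist w] := Hc h k.
  exists (gdist h k) => //.
  exact: (@leq_bigmax_seq _ L xpredT (fun k => gdist h k)).
- move=> k kL; have [n /walk_gdist w] := Gc (sval p k) (sval q k).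
  exists (gdist (sval p k) (sval q k)) => //.
  exact: (@leq_bigmax_seq _ L xpredT (fun k => gdist (sval p k) (sval q k))).
have [m w'] := Hc h h'.
by exists (n + m)%N; apply: walk_cat w (wreath_walk_move q w').
Qed.

(** Bounded degree bounds the number of places within [r] of the first cursor, hence the number of
    excursions. A last walk of length at most [r] reaches the second cursor. *)
Lemma wreath_gdist_le : uniformly_locally_finite H -> connected_graph G ->
  connected_graph H -> forall r s, exists M, forall x y : wreath o H,
  (gdist x.2 y.2 <= r)%N ->
  (forall k, sval x.1 k <> sval y.1 k -> (gdist x.2 k <= r)%N) ->
  (forall k, (gdist (sval x.1 k) (sval y.1 k) <= s)%N) ->
  (gdist x y <= M)%N.
Proof.
move=> [d deg_le] [_ Gc] [_ Hc] r s.
have [B [Bsize BP]] := ball_enumeration deg_le.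
exists (d.+1 ^ r * (r + s + r) + r)%N => -[p h] [q h'] /= hr pr ps.
pose L := [seq k <- B r h | `[< sval p k <> sval q k >]].
have Hw k : walk h k (gdist h k) by have [n /walk_gdist] := Hc h k.
have [||| n nL w] := @wreath_walk_list L p q h r s.
- move=> k pq; rewrite mem_filter asboolT//=.
  by apply: BP (Hw k); exact: pr.
- move=> k; rewrite mem_filter => /andP[/asboolP /pr kr _].
  by exists (gdist h k).
- move=> k _; have [n /walk_gdist w] := Gc (sval p k) (sval q k).
  by exists (gdist (sval p k) (sval q k)).
apply: leq_trans (gdist_le (walk_cat w (wreath_walk_move q (Hw h')))) _.
apply: leq_add => //; apply: (leq_trans nL); rewrite leq_mul2r -(Bsize r h).
by rewrite size_filter count_size orbT.
Qed.

Lemma coarsely_embeds_wreath_base (R : realType) :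
  connected_graph H -> coarsely_embeds_in_Hilbert R (wreath o H) ->
  coarsely_embeds_in_Hilbert R H.
Proof.
move=> Hc; apply: (@coarsely_embeds_of_retract _ _ _
  (fun h => (lamp_off, h) : wreath o H) (fun x : wreath o H => x.2)) => //.
  by move=> x y xy; apply/asboolP; left.
by move=> u v /asboolP[[_]|[? _ _]]; [right|left].
Qed.

Lemma coarsely_embeds_wreath_fiber (R : realType) :
  connected_graph G -> inhabited H ->
  coarsely_embeds_in_Hilbert R (wreath o H) -> coarsely_embeds_in_Hilbert R G.
Proof.
move=> Gc [h0]; apply: (@coarsely_embeds_of_retract _ _ _
  (fun g => (lamp_set lamp_off h0 g, h0) : wreath o H)
  (fun x : wreath o H => sval x.1 h0)) => //.
- by move=> x; rewrite lamp_setE.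
- move=> x y xy; apply/asboolP; right; split; rewrite ?lamp_setE//.
  by move=> k kh; rewrite !lamp_setNE.
move=> u v /asboolP[[-> _]|[uv uvk uvadj]]; first by left.
have [->|/uvk] := pselect (h0 = u.2); last by left.
by right.
Qed.

End WreathWalks.

(** * The wreath product kernel *)

Section Orthonormal.
Variables (R : realType) (V : hilbertSpace R).
Implicit Types (b s : seq V) (y z e : V).

Definition ip : V -> V -> R := inner V.

Lemma ipC y z : ip y z = ip z y.
Proof. by rewrite /ip (hermC (inner V)) expr0 mul1r. Qed.

Lemma ipDl y z w : ip (y + z) w = ip y w + ip z w.
Proof. exact: linearDl. Qed.

Lemma ipZl a y z : ip (a *: y) z = a * ip y z.
Proof. exact: linearZl_LR. Qed.

Lemma ipBl y z w : ip (y - z) w = ip y w - ip z w.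
Proof. by rewrite -scaleN1r ipDl ipZl mulN1r. Qed.

Lemma ip_norm y : ip y y = `|y| ^+ 2.
Proof. by rewrite inner_norm. Qed.

Lemma normB_sqr y z : `|y - z| ^+ 2 = `|y| ^+ 2 - 2 * ip y z + `|z| ^+ 2.
Proof.
by rewrite -!ip_norm ipBl !(ipC _ (y - z)) !ipBl (ipC z y); ring.
Qed.

Lemma ip_le y z : `|ip y z| <= `|y| * `|z|.
Proof.
have [->|z0] := eqVneq z 0.
  by rewrite ipC -(scale0r z) ipZl mul0r !normr0 ?scale0r ?normr0 mulr0.
have z1 : 0 < `|z| by rewrite normr_gt0.
rewrite -(ler_pXn2r (n := 2)) ?nnegrE ?mulr_ge0//.
rewrite real_normK ?num_real// exprMn.
have := sqr_ge0 `|y - (ip y z / `|z| ^+ 2) *: z|.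
rewrite normB_sqr normrZ exprMn real_normK ?num_real// ipC ipZl (ipC z y).
have -> : `|y| ^+ 2 - 2 * (ip y z / `|z| ^+ 2 * ip y z) +
    (ip y z / `|z| ^+ 2) ^+ 2 * `|z| ^+ 2 = `|y| ^+ 2 - ip y z ^+ 2 / `|z| ^+ 2.
  by field; rewrite gt_eqF.
by rewrite subr_ge0 ler_pdivrMr// exprn_gt0.
Qed.

Definition orth_proj b y := \sum_(e <- b) ip y e *: e.

Lemma orth_proj_cons e b y : orth_proj (e :: b) y = ip y e *: e + orth_proj b y.
Proof. by rewrite /orth_proj big_cons. Qed.

Lemma orth_projB b y z :
  orth_proj b (y - z) = orth_proj b y - orth_proj b z.
Proof.
by rewrite /orth_proj -sumrB; apply: eq_bigr => e _; rewrite ipBl scalerBl.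
Qed.

Lemma orthonormal_cons e b : orthonormal (inner V) (e :: b) =
  [&& ip e e == 1, all (fun z => ip e z == 0) b & orthonormal (inner V) b].
Proof.
by rewrite /orthonormal /= /ortho_rec /= andbT -!andbA; congr (_ && _);
   rewrite andbCA.
Qed.

Lemma ip_orth_proj e b y : all (fun z => ip e z == 0) b -> ip (orth_proj b y) e = 0.
Proof.
elim: b => [_|z b IH /= /andP[/eqP ez /IH bz]].
  by rewrite /orth_proj big_nil -(scale0r 0) ipZl mul0r.
by rewrite orth_proj_cons ipDl ipZl bz (ipC z) ez; ring.
Qed.

Lemma orth_proj_residual b y e : orthonormal (inner V) b -> e \in b ->
  ip (y - orth_proj b y) e = 0.
Proof.
elim: b => [//|z b IH]; rewrite orthonormal_cons => /and3P[/eqP zz zb bo].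
rewrite inE orth_proj_cons opprD addrA addrAC ipBl ipZl => /predU1P[->|eb].
  by rewrite zz ipBl ip_orth_proj//; ring.
by rewrite IH// (eqP (allP zb _ eb)); ring.
Qed.

Lemma orth_proj_residual_norm b y : orthonormal (inner V) b ->
  `|y - orth_proj b y| ^+ 2 = `|y| ^+ 2 - \sum_(e <- b) ip y e ^+ 2.
Proof.
elim: b => [|z b IH]; first by rewrite /orth_proj !big_nil !subr0.
rewrite orthonormal_cons => /and3P[/eqP zz zb bo].
rewrite orth_proj_cons big_cons opprD addrA addrAC normB_sqr IH//.
rewrite -(ip_norm (_ *: z)) ipZl (ipC z) ipZl zz.
by rewrite (ipC (_ - _)) ipZl (ipC z) ipBl ip_orth_proj//; ring.
Qed.

Lemma bessel b y : orthonormal (inner V) b ->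
  \sum_(e <- b) ip y e ^+ 2 <= `|y| ^+ 2.
Proof. by move=> /(orth_proj_residual_norm y) e; rewrite -subr_ge0 -e sqr_ge0. Qed.

Lemma parseval b y : orthonormal (inner V) b -> orth_proj b y = y ->
  \sum_(e <- b) ip y e ^+ 2 = `|y| ^+ 2.
Proof.
move=> /(orth_proj_residual_norm y) + yb; rewrite yb subrr normr0 expr0n/= => /eqP.
by rewrite eq_sym subr_eq0 => /eqP.
Qed.

(** Gram-Schmidt: the normalized residual is added only when it is nonzero. *)
Lemma orthonormal_spanning s : exists b,
  orthonormal (inner V) b /\ forall y, y \in s -> orth_proj b y = y.
Proof.
elim: s => [|y s [b [bo bs]]]; first by exists [::].
pose r := y - orth_proj b y; have yE : y = r + orth_proj b y by rewrite subrK.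
have rb : all (fun z => ip r z == 0) b.
  by apply/allP => e eb; rewrite orth_proj_residual.
have [r0|r0] := eqVneq r 0.
  exists b; split => // z; rewrite inE => /predU1P[->|/bs//].
  by rewrite {2}yE r0 add0r.
have n0 : `|r| != 0 by rewrite normr_eq0.
pose e := `|r|^-1 *: r.
have be : all (fun z => ip e z == 0) b.
  by apply/allP => z /(allP rb) /eqP rz; rewrite ipZl rz mulr0.
have ee : ip e e = 1.
  by rewrite ip_norm normrZ normfV normr_id mulVf// expr1n.
exists (e :: b); split; first by rewrite orthonormal_cons ee eqxx be.
move=> z; rewrite inE orth_proj_cons => /predU1P[->|zs].
  have -> : ip y e = `|r|.
    by rewrite yE ipDl ip_orth_proj// addr0 ipC ipZl ip_norm; field.
  by rewrite scalerA mulfV// scale1r -yE.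
by rewrite -{1}(bs z zs) ip_orth_proj// scale0r add0r bs.
Qed.

End Orthonormal.

(** * Cuts of the wreath product by half-spaces *)

Section HalfspaceKernel.
Variables (R : realType) (V : hilbertSpace R) (G H : graph) (o : G).
Variable f : H -> V.
Implicit Types (x y : wreath o H) (u : V) (m : R).

(* Each half-space [A = {h | m <= <f h, u>}] of [H] and each configuration [c]
   outside [A] cut the wreath product along the set of all [(p, h)] with
   [h \in A] and [p = c] outside [A]. *)
Definition halfspace_kernel u m x y : R :=
  cut_kernel R (fun z : wreath o H => m <= ip (f z.2) u)
    (fun z k => if m <= ip (f k) u then o else sval z.1 k) x y.

Lemma halfspace_kernel_negative_type u m : negative_type (halfspace_kernel u m).
Proof. exact: cut_kernel_negative_type. Qed.

(** The left side is positive only if [x.2] lies in the half-space and [k] does not. Then either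
    [y.2], being [k], is outside too, or the labels differ at [k]; in both cases a cut separates [x]
    from [y]. *)
Lemma halfspace_kernel_ge u m x y k :
  k = y.2 \/ sval x.1 k <> sval y.1 k ->
  (m <= ip (f x.2) u)%R%:R - (m <= ip (f k) u)%R%:R <= halfspace_kernel u m x y.
Proof.
move=> kP; have ge0 := negative_type_ge0 x y (halfspace_kernel_negative_type u m).
have [mx|mx] := leP m (ip (f x.2) u); last first.
  by have := ler0n R (m <= ip (f k) u)%R; rewrite /=; lra.
have [mk|mk] := leP m (ip (f k) u); first by rewrite subrr.
rewrite /halfspace_kernel /cut_kernel mx.
case: (leP m (ip (f y.2) u)) => my; last by rewrite andbF /=; lra.
rewrite asboolF /=; first lra.
move=> /(congr1 (@^~ k)) /=; rewrite leNgt mk /=.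
by case: kP => [ky|//]; rewrite ky ltNge my in mk.
Qed.

Lemma halfspace_kernel_base u m x y : x.1 = y.1 ->
  ip (f x.2) u <= ip (f y.2) u ->
  halfspace_kernel u m x y =
    (m <= ip (f y.2) u)%R%:R - (m <= ip (f x.2) u)%R%:R.
Proof.
move=> xy le; rewrite /halfspace_kernel /cut_kernel xy asboolT// andbT.
case: (leP m (ip (f x.2) u)) => mx /=; last by lra.
by rewrite (le_trans mx le) /=; lra.
Qed.

(** Either the cursor is outside the half-space, and no cut contains [x] or [y], or it is inside,
    where the label masks the changed lamp. *)
Lemma halfspace_kernel_fiber u m x y : x.2 = y.2 ->
  (forall k, k <> x.2 -> sval x.1 k = sval y.1 k) ->
  halfspace_kernel u m x y = 0.
Proof.
move=> xy2 xy1; rewrite /halfspace_kernel /cut_kernel -xy2.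
case: (leP m (ip (f x.2) u)) => mx /=; last by lra.
rewrite asboolT /=; first lra.
apply/funext => k; case: (leP m (ip (f k) u)) => // mk.
by apply: xy1 => kx; rewrite kx ltNge mx in mk.
Qed.

Definition range_kernel (M : nat) u x y : R :=
  \sum_(j < M.*2) halfspace_kernel u (j%:R - M%:R) x y.

Lemma range_kernel_negative_type M u : negative_type (range_kernel M u).
Proof.
apply: (@negative_type_sum _ _
  (fun j => halfspace_kernel u (j%:R - M%:R))) => j.
exact: halfspace_kernel_negative_type.
Qed.

Lemma range_kernel_fiber M u x y : x.2 = y.2 ->
  (forall k, k <> x.2 -> sval x.1 k = sval y.1 k) -> range_kernel M u x y = 0.
Proof.
by move=> e1 e2; apply: big1 => j _; exact: halfspace_kernel_fiber.
Qed.

Lemma sum_threshold M (t : R) :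
  \sum_(j < M.*2) (j%:R - M%:R <= t)%R%:R = threshold_count M.*2 (t + M%:R).
Proof. by apply: eq_bigr => j _; rewrite lerBlDr. Qed.

Lemma range_kernel_base M u x y : x.1 = y.1 ->
  range_kernel M u x y <= `|ip (f x.2 - f y.2) u| + 1.
Proof.
wlog le : x y / ip (f x.2) u <= ip (f y.2) u => [wlg xy|xy].
  have [le|/ltW le] := leP (ip (f x.2) u) (ip (f y.2) u); first exact: wlg.
  have [-> _ _] := range_kernel_negative_type M u.
  by rewrite -normrN -(mulN1r (ip _ _)) -ipZl scaleN1r opprB wlg.
rewrite /range_kernel; under eq_bigr do rewrite halfspace_kernel_base//.
rewrite sumrB !sum_threshold.
apply: (le_trans (threshold_countB _ _)); first by rewrite lerD2r.
rewrite lerD2r ipBl distrC ger0_norm ?subr_ge0//; lra.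
Qed.

Lemma range_kernel_ge M u x y k :
  k = y.2 \/ sval x.1 k <> sval y.1 k ->
  `|ip (f x.2) u| <= M%:R -> `|ip (f k) u| <= M%:R ->
  Num.max 0 (ip (f x.2 - f k) u) - 1 <= range_kernel M u x y.
Proof.
move=> kP; rewrite !ler_norml => /andP[xl xr] /andP[kl kr].
have ge0 := negative_type_ge0 x y (range_kernel_negative_type M u).
suff : ip (f x.2) u - ip (f k) u - 1 <= range_kernel M u x y.
  by rewrite ipBl; case: (leP 0 _) => _; lra.
(* With both inner products in [-M, M], shifting by [M] puts them where the count agrees with the
   identity up to 1, so the truncation does no harm. *)
have : threshold_count M.*2 (ip (f x.2) u + M%:R) -
    threshold_count M.*2 (ip (f k) u + M%:R) <= range_kernel M u x y.
  rewrite -!sum_threshold -sumrB; apply: ler_sum => j _.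
  exact: halfspace_kernel_ge.
have : ip (f k) u + M%:R <= (M.*2)%:R by rewrite -addnn natrD lerD2r.
have := @threshold_count_ge R M.*2 (ip (f x.2) u + M%:R).
rewrite -{1}addnn natrD lerD2r => /(_ xr).
have := @threshold_count_le R M.*2 (ip (f k) u + M%:R).
by rewrite -lerBlDr sub0r => /(_ kl); lra.
Qed.

End HalfspaceKernel.

(** * Bounds for the combined kernel *)

Section WreathEmbedding.
Variables (R : realType) (VG VH : hilbertSpace R) (G H : graph) (o : G).
Variables (fG : G -> VG) (fH : H -> VH).
Variables (e : nat -> H) (idx : H -> nat).
Hypothesis idxK : cancel idx e.
Implicit Types x y : wreath o H.

(** A sign sum over an orthonormal [b] has norm at most [size b], so the cutoff [N * size b] covers
    the inner products with every [fH h] of norm at most [N]. *)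
Definition base_kernel (b : seq VH) (N : nat) x y : R :=
  signmean b (fun u => range_kernel fH (N * size b) u x y).

(** The factor [idx (e j) == j] counts each vertex once although [e] may repeat it. *)
Definition lamp_kernel (N : nat) x y : R :=
  \sum_(j < N)
    (idx (e j) == j)%:R * `|fG (sval x.1 (e j)) - fG (sval y.1 (e j))| ^+ 2.

Lemma base_kernel_negative_type b N : negative_type (base_kernel b N).
Proof.
by apply: negative_type_signmean => u; exact: range_kernel_negative_type.
Qed.

Lemma lamp_kernel_negative_type N : negative_type (lamp_kernel N).
Proof.
apply: (@negative_type_sum _ _ (fun j x y => (idx (e j) == j)%:R *
  `|fG (sval x.1 (e j)) - fG (sval y.1 (e j))| ^+ 2)) => j.
apply: (@negative_typeZ _ _ _ (fun x y =>
  `|fG (sval x.1 (e j)) - fG (sval y.1 (e j))| ^+ 2)); first exact: ler0n.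
exact: (sqr_dist_negative_type (fun x => fG (sval x.1 (e j)))).
Qed.

(** Since t + 1 <= t^2 + 2, the mean is controlled by a second moment, which Bessel's inequality
    bounds independently of [b] and [N]. *)
Lemma base_kernel_base b N x y : orthonormal (inner VH) b -> x.1 = y.1 ->
  base_kernel b N x y <= `|fH x.2 - fH y.2| ^+ 2 + 2.
Proof.
move=> bo xy; pose L : {additive VH -> R} := inner VH (fH x.2 - fH y.2).
have : base_kernel b N x y <= signmean b (fun u => L u ^+ 2 + 2).
  apply: le_signmean => u _; apply: (le_trans (range_kernel_base fH _ u xy)).
  rewrite -[ip _ u]/(L u) -(real_normK (num_real (L u))).
  have := sqr_ge0 (`|L u| - 1); have := sqr_ge0 `|L u|; nra.
move=> /le_trans; apply; rewrite signmeanD signmean_cst signmean_sqr lerD2r.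
exact: bessel.
Qed.

Lemma base_kernel_fiber b N x y : x.2 = y.2 ->
  (forall k, k <> x.2 -> sval x.1 k = sval y.1 k) -> base_kernel b N x y = 0.
Proof.
move=> e1 e2; rewrite /base_kernel.
under eq_fun do rewrite range_kernel_fiber//.
exact: signmean_cst.
Qed.

Lemma lamp_kernel_base N x y : x.1 = y.1 -> lamp_kernel N x y = 0.
Proof.
move=> xy; rewrite /lamp_kernel big1// => j _.
by rewrite xy subrr normr0 expr0n mulr0.
Qed.

Lemma lamp_kernel_fiber N x y : (forall k, k <> x.2 -> sval x.1 k = sval y.1 k) ->
  lamp_kernel N x y <= `|fG (sval x.1 x.2) - fG (sval y.1 x.2)| ^+ 2.
Proof.
move=> xy; set D := leRHS.
have D0 : 0 <= D by exact: sqr_ge0.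
have le1 : lamp_kernel N x y <= \sum_(j < N) ((j : nat) == idx x.2)%:R * D.
  apply: ler_sum => j _; have [je|] := eqVneq (idx (e j)) j; last first.
    by rewrite mul0r mulr_ge0.
  have [ex|ex] := pselect (e j = x.2); last first.
    by rewrite xy// subrr normr0 expr0n mulr0 mulr_ge0.
  have jx : (j : nat) = idx x.2 by rewrite -je ex.
  by rewrite ex jx eqxx.
apply: (le_trans le1); rewrite -mulr_suml ler_piMl//.
have [iN|iN] := ltnP (idx x.2) N; last first.
  rewrite big1// => j _; rewrite ltn_eqF//.
  exact: leq_trans (ltn_ord j) iN.
rewrite (bigD1 (Ordinal iN))//= eqxx big1 ?addr0// => j jN.
by rewrite -[(j : nat) == _]/(j == Ordinal iN) (negPf jN).
Qed.

Lemma lamp_kernel_ge N x y k : (idx k < N)%N ->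
  `|fG (sval x.1 k) - fG (sval y.1 k)| ^+ 2 <= lamp_kernel N x y.
Proof.
move=> kN; rewrite /lamp_kernel (bigD1 (Ordinal kN))//= !idxK eqxx mul1r.
by rewrite lerDl sumr_ge0// => j _; rewrite mulr_ge0 ?sqr_ge0.
Qed.

(** Khintchine's inequality for [L]; as both vectors lie in the span of [b], Parseval identifies its
    second moment with the squared distance. *)
Lemma base_kernel_ge b N x y k : orthonormal (inner VH) b ->
  k = y.2 \/ sval x.1 k <> sval y.1 k ->
  `|fH x.2| <= N%:R -> `|fH k| <= N%:R ->
  orth_proj b (fH x.2) = fH x.2 -> orth_proj b (fH k) = fH k ->
  `|fH x.2 - fH k| / 9 - 1 <= base_kernel b N x y.
Proof.
move=> bo kP xN kN bx bk.
pose L : {additive VH -> R} := inner VH (fH x.2 - fH k).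
have sumE : \sum_(z <- b) `|z| = (size b)%:R.
  have : all [pred z | inner VH z z == 1] b by case/andP: bo.
  elim: (b) => [|z s IH] /=; first by rewrite big_nil.
  rewrite -inner_norm sqrp_eq1// => /andP[/eqP z1 /IH sE].
  by rewrite big_cons z1 sE -natr1 addrC.
have ip_bound h u : `|fH h| <= N%:R -> `|u| <= \sum_(z <- b) `|z| ->
    `|ip (fH h) u| <= (N * size b)%:R.
  move=> hN ub; apply: (le_trans (ip_le _ _)).
  by rewrite natrM ler_pM// -sumE.
have : signmean b (fun u => Num.max 0 (L u) + -1) <= base_kernel b N x y.
  apply: le_signmean => u ub.
  by apply: range_kernel_ge => //; exact: ip_bound.
rewrite signmeanD signmean_cst; apply: le_trans; rewrite lerD2r.
apply: khintchine => //; rewrite -[RHS]/(\sum_(z <- b) ip _ z ^+ 2).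
by rewrite parseval// orth_projB bx bk.
Qed.

Lemma wreath_coarsely_embeds :
  connected_graph G -> connected_graph H -> uniformly_locally_finite H ->
  coarse_embedding (fun x y : G => (gdist x y)%:R : R) (fun u v => `|u - v|) fG ->
  coarse_embedding (fun x y : H => (gdist x y)%:R : R) (fun u v => `|u - v|) fH ->
  coarsely_embeds_in_Hilbert R (wreath o H).
Proof.
move=> Gc Hc Hulf /coarse_embedding_bounds[[CG CG0 fGC] fGM].
move=> /coarse_embedding_bounds[[CH CH0 fHC] fHM].
have /choice[b bP] : forall N, exists b : seq VH, orthonormal (inner VH) b /\
    forall j, (j < N)%N -> orth_proj b (fH (e j)) = fH (e j).
  move=> N; have [b [bo bs]] := orthonormal_spanning [seq fH (e j) | j <- iota 0 N].
  exists b; split => // j jN; apply: bs; apply/mapP; exists j => //.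
  by rewrite mem_iota.
apply: (@coarsely_embeds_of_limit _ _
  (fun N x y => base_kernel (b N) N x y + lamp_kernel N x y)).
- exact: wreath_connected.
- move=> N; apply: negative_typeD; first exact: base_kernel_negative_type.
  exact: lamp_kernel_negative_type.
- exists (CH ^+ 2 + 2 + CG ^+ 2) => N x y /asboolP[[xy1 xy2]|[xy2 xy1 xyadj]].
    rewrite lamp_kernel_base// addr0.
    apply: (le_trans (base_kernel_base N (bP N).1 xy1)).
    have : `|fH x.2 - fH y.2| ^+ 2 <= CH ^+ 2.
      by rewrite ler_sqr ?nnegrE//; exact: fHC.
    have := sqr_ge0 CG; lra.
  rewrite base_kernel_fiber// add0r.
  apply: (le_trans (lamp_kernel_fiber N xy1)).
  have : `|fG (sval x.1 x.2) - fG (sval y.1 x.2)| ^+ 2 <= CG ^+ 2.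
    by rewrite ler_sqr ?nnegrE//; exact: fGC.
  have := sqr_ge0 CH; lra.
(* Beyond [r], Khintchine's bound gives more than (|B| + 1) - 1 >= B; beyond [s], a single lamp
   contributes more than (|B| + 1)^2 >= B. *)
move=> B; have [r rP] := fHM (9 * (`|B| + 1)); have [s sP] := fGM (`|B| + 1).
have [M MP] := wreath_gdist_le o Hulf Gc Hc r s; exists M => x y xyM.
have lampB k : (s < gdist (sval x.1 k) (sval y.1 k))%N ->
    \forall N \near \oo, B <= base_kernel (b N) N x y + lamp_kernel N x y.
  move=> far; near=> N.
  have := negative_type_ge0 x y (base_kernel_negative_type (b N) N).
  have /(lamp_kernel_ge x y) : (idx k < N)%N by near: N; exact: nbhs_infty_gt.
  have : `|B| + 1 < `|fG (sval x.1 k) - fG (sval y.1 k)|.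
    by rewrite ltNge; apply/negP => /sP; rewrite leqNgt far.
  have := ler_norm B; have := normr_ge0 B; nra.
have baseB k : k = y.2 \/ sval x.1 k <> sval y.1 k -> (r < gdist x.2 k)%N ->
    \forall N \near \oo, B <= base_kernel (b N) N x y + lamp_kernel N x y.
  move=> kP far; near=> N.
  have := negative_type_ge0 x y (lamp_kernel_negative_type N).
  have projE h : (idx h < N)%N -> orth_proj (b N) (fH h) = fH h.
    by move=> hN; rewrite -{1 2}(idxK h) (bP N).2.
  have := @base_kernel_ge (b N) N x y k (bP N).1 kP.
  have fN h : (Num.trunc `|fH h| < N)%N -> `|fH h| <= N%:R.
    move=> hN; apply: (le_trans (ltW (truncnS_gt _))).
    by rewrite ler_nat.
  have -> := fN x.2; last by near: N; exact: nbhs_infty_gt.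
  have -> := fN k; last by near: N; exact: nbhs_infty_gt.
  have -> := projE x.2; last by near: N; exact: nbhs_infty_gt.
  have -> := projE k; last by near: N; exact: nbhs_infty_gt.
  move=> /(_ isT isT erefl erefl).
  have : 9 * (`|B| + 1) < `|fH x.2 - fH k|.
    by rewrite ltNge; apply/negP => /rP; rewrite leqNgt far.
  have := ler_norm B; lra.
(* A far cursor or a far place of difference makes the base kernel large, a far lamp value the lamp
   kernel. If none occurs, [MP] contradicts [xyM]. *)
have [|kr] := ltnP r (gdist x.2 y.2); first by apply: baseB; left.
apply: contrapT => nB; move: xyM; rewrite ltnNge => /negP; apply.
apply: MP => // k; last by rewrite leqNgt; apply/negP => /lampB.
by move=> xyk; rewrite leqNgt; apply/negP => /(baseB k (or_intror xyk)).
Unshelve. all: by end_near. Qed.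

End WreathEmbedding.

Theorem theorem1p4 (R : realType) (G H : graph) (o : G)
    (G_connected : connected_graph G) (H_connected : connected_graph H)
    (H_ulf : uniformly_locally_finite H) :
  coarsely_embeds_in_Hilbert R (wreath o H) <->
  coarsely_embeds_in_Hilbert R G /\ coarsely_embeds_in_Hilbert R H.
Proof.
split=> [wr|[[VG [fG fGP]] [VH [fH fHP]]]].
  split; last exact: coarsely_embeds_wreath_base wr.
  exact: coarsely_embeds_wreath_fiber H_connected.1 wr.
have [d deg_le] := H_ulf.
have [e [idx idxK]] := vertex_enumeration deg_le H_connected.
exact: (wreath_coarsely_embeds o idxK G_connected H_connected H_ulf fGP fHP).
Qed.
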